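(* Let $g \ge 2$ and $k \ge 2$ be integers, let $d = \binom{k}{2}(g-1)$, and let $D_1, D_2 > 0$ be constants as described in the context. Suppose that $0<\delta < \frac{8}{5} g^{-k-3}k^{-2}$, and let $t$ be a positive integer multiple of $g$ such that $t < 2 (d \delta)^{-3}$. If $g$ is odd, or if $g$ and $t/g$ are both even, then \[ \mathbb{P}(X_t = \vec 0) \leq \frac{g^{\frac{g}{2} \binom{k}{2} + \binom{k-1}{2}}}{\sqrt{(2 \pi t)^{d}}} U(g , k, t, \delta) + \exp \left({- \tfrac{11}{192} g^{-k} t \delta^2} \right)\] and \[ \mathbb{P}(X_t = \vec 0) \geq\frac{g^{\frac{g}{2} \binom{k}{2} + \binom{k-1}{2}}}{\sqrt{(2 \pi t)^{d}}} L(g , k, t, \delta) - \exp \left({- \tfrac{11}{192} g^{-k} t \delta^2}\right),\] where \[ L(g, k, t, \delta) = [1 + t^2(d \delta)^6]^{-1/2} \left[ 1 - \tfrac{1}{3}(d \delta)^4 \right]^t [1 - e^{-\frac{t}{2} (D_1\delta)^2}]^{d/2},\] \[ U(g, k, t, \delta) = \left[ 1 + \tfrac{1}{4}(d \delta)^6 \right]^{t/2} \left[ 1 + \tfrac{1}{3} ( d \delta)^4 \right]^t [1 - e^{- t (D_2 \delta)^2}]^{d/2}.\]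
   Context: Let $\mathbb Z_g$ be the integers mod $g$ and $d=\binom{k}{2}(g-1)$. Index the coordinates of $\mathbb R^d$ by pairs $(\{i,j\},a)$ with $1\le i<j\le k$ and $a\in\mathbb Z_g\setminus\{0\}$. Define $Z:(\mathbb Z_g)^k\to\mathbb R^d$ by $[Z(\vec x)]_{\{i,j\},a}=1-1/g$ if $x_i-x_j=a$ and $-1/g$ otherwise. Let $X_t=Z(\vec x_1)+\dots+Z(\vec x_t)$ where $\vec x_1,\vec x_2,\dots$ are independent and uniformly distributed on $(\mathbb Z_g)^k$ (a random walk on $\mathbb R^d$ started at $\vec 0$). Let $M$ be the $d\times d$ matrix indexed like $\mathbb R^d$ with $M_{(\{i,j\},a),(\{m,n\},b)}=\frac{g-1}{g^2}$ if $\{i,j\}=\{m,n\}$ and $a=b$, $-\frac{1}{g^2}$ if $\{i,j\}=\{m,n\}$ and $a\ne b$, and $0$ if $\{i,j\}\ne\{m,n\}$. The constants $D_1,D_2>0$ depend only on $g$ and have the property that there is a symmetric matrix $P$ with $P^2=M$ such that for all $\delta>0$, $[-D_1\delta,D_1\delta]^d\subset P[-\delta,\delta]^d\subset[-D_2\delta,D_2\delta]^d$, where $P[-\delta,\delta]^d=\{P\vec\mu:\vec\mu\in[-\delta,\delta]^d\}$ (such constants exist). *)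

(* Defs.v *)
From HB Require Import structures.
From mathcomp Require Import all_boot all_order all_algebra.
From mathcomp Require Import all_classical all_reals all_analysis.
Set Implicit Arguments. Unset Strict Implicit. Unset Printing Implicit Defensive.
Import Order.TTheory GRing.Theory Num.Theory.
Local Open Scope ring_scope.

(* Coordinates of R^d: pairs ({i,j}, a) with i < j in 'I_k and a in Z_g \ {0}.
   Z_g is represented by 'I_g with arithmetic mod g (g >= 2 assumed in the theorem). *)
Definition coord (k g : nat) : finType :=
  {c : ('I_k * 'I_k) * 'I_g | (c.1.1 < c.1.2)%N && (nat_of_ord c.2 != 0%N)}.

Definition dimd (k g : nat) : nat := ('C(k, 2) * (g - 1))%N.

Definition zdiff (g : nat) (u v : 'I_g) : nat := ((u + g - v) %% g)%N.

Definition Zvec (R : realType) (k g : nat) (x : {ffun 'I_k -> 'I_g})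
  (c : coord k g) : R :=
  let: ((i, j), a) := val c in
  if zdiff (x i) (x j) == nat_of_ord a then 1 - (g%:R)^-1 else - (g%:R)^-1.

(* P(X_t = 0): the steps x_1..x_t are independent uniform on (Z_g)^k, i.e. the
   sequence (x_1,...,x_t) is uniform on ((Z_g)^k)^t; the probability is the
   proportion of such sequences with X_t = Z(x_1)+...+Z(x_t) = 0. *)
Definition prob_return (R : realType) (k g t : nat) : R :=
  (#|[set w : {ffun 'I_t -> {ffun 'I_k -> 'I_g}} |
      [forall c : coord k g, \sum_(s < t) Zvec R (w s) c == 0]]|%:R)
  / (#|{: {ffun 'I_t -> {ffun 'I_k -> 'I_g}}}|%:R).

Definition Mmat (R : realType) (k g : nat) (c c' : coord k g) : R :=
  if (val c).1 == (val c').1 then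
    (if (val c).2 == (val c').2 then (g%:R - 1) / (g%:R ^+ 2) else - (g%:R ^+ 2)^-1)
  else 0.

Definition good_constants (R : realType) (k g : nat) (D1 D2 : R) : Prop :=
  exists P : coord k g -> coord k g -> R,
    (forall c c', P c c' = P c' c) /\
    (forall c c', \sum_(l : coord k g) P c l * P l c' = Mmat R c c') /\
    (forall delta : R, 0 < delta ->
       (forall v : coord k g -> R, (forall c, `|v c| <= D1 * delta) ->
          exists mu : coord k g -> R, (forall c, `|mu c| <= delta) /\
            (forall c, v c = \sum_(l : coord k g) P c l * mu l)) /\
       (forall mu : coord k g -> R, (forall c, `|mu c| <= delta) ->
          forall c, `|\sum_(l : coord k g) P c l * mu l| <= D2 * delta)).

Definition Lbd (R : realType) (k g t : nat) (D1 delta : R) : R :=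
  let d := (dimd k g)%:R in
  (1 + (t%:R) ^+ 2 * (d * delta) ^+ 6) `^ (- (1 / 2))
  * (1 - (d * delta) ^+ 4 / 3) ^+ t
  * (1 - expR (- (t%:R / 2) * (D1 * delta) ^+ 2)) `^ (d / 2).

Definition Ubd (R : realType) (k g t : nat) (D2 delta : R) : R :=
  let d := (dimd k g)%:R in
  (1 + (d * delta) ^+ 6 / 4) `^ (t%:R / 2)
  * (1 + (d * delta) ^+ 4 / 3) ^+ t
  * (1 - expR (- t%:R * (D2 * delta) ^+ 2)) `^ (d / 2).

Definition main_coef (R : realType) (k g t : nat) : R :=
  (g%:R : R) `^ (g%:R / 2 * ('C(k, 2))%:R + ('C(k.-1, 2))%:R)
  / Num.sqrt ((2 * pi * t%:R) ^+ dimd k g).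

Definition err_term (R : realType) (k g t : nat) (delta : R) : R :=
  expR (- (11 / 192) * (g%:R ^- k) * t%:R * delta ^+ 2).

(* Main.v *)
(** By finite Fourier inversion, for every [N > t] the return probability is the
    average of [phi ^ t] over the grid [2 pi / N * Z_N ^ d], where [phi] is the
    characteristic function of one step.

    [phi] has modulus 1 exactly at the points [theta_({i,j},a) = 2 pi c_ij a / g],
    where [c] is a [Z_g]-valued circulation on the complete graph [K_k]; there are
    [g ^ C(k-1, 2)] of them, and the parity assumption makes [phi ^ t] invariant
    under translation by each.  A point which is not [delta]-close to a peak has two
    phases at distance at least [delta / 2] modulo [2 pi], since mixed second
    differences of the phase recover almost-homomorphisms [Z_g -> R / 2 pi Z], and
    this bounds [|phi|].  Near [0] a Taylor expansion compares [phi ^ t] with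
    [exp (- t theta^T M theta / 2)].

    The Gaussian sum over a box factors over the pairs [{i,j}].  On one pair,
    [M = (g I - J) / g ^ 2], and linearising the rank one part by an auxiliary Gaussian
    variable reduces the box sum to powers of one-dimensional sums: a bound
    uniform in the auxiliary variable gives the upper bound, and convexity the lower
    bound.  The constants enter only through [D1 <= 1 / g], [D2 ^ 2 >= 1 / g] if
    [g > 2], and [D2 ^ 2 >= 1 / 4] if [g = 2].  Then [N] tends to infinity along
    the multiples of [g]. *)

Require Import Defs.
From HB Require Import structures.
From mathcomp Require Import all_boot all_order all_algebra.
From mathcomp Require Import all_classical all_reals all_analysis.
From mathcomp Require Import measurable_realfun.
From mathcomp Require Import ring lra zify complex.
Import Order.TTheory GRing.Theory Num.Theory.
Import numFieldNormedType.Exports Normc.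

Set Implicit Arguments. Unset Strict Implicit. Unset Printing Implicit Defensive.
Local Open Scope classical_set_scope.
Local Open Scope ring_scope.

(* [all_algebra] shadows [coord] by the coordinate function of vector.v *)
Local Notation coord := Defs.coord.

(** Replacing the torus by a grid keeps every [d]-dimensional object a finite sum; only
    one-dimensional integrals occur. [N > t] prevents aliasing, and [g] dividing [N] puts the peaks
    on the grid. The factors [1 - exp (...)] come from the Gaussian mass of a square, which lies
    between the masses of its inscribed and circumscribed discs. No change of variables by [P] is
    made: the box stays a box in [theta]. On each pair [M] has eigenvalue [1 / g] on vectors of sum
    zero and [1 / g ^ 2] on constants, whence the inequalities for [D1] and [D2]. Averaging over the
    auxiliary variable halves the exponent of the lower bound, to [t delta ^ 2 / (4 g)]; as
    [D1 <= 1 / g] and [g >= 2], this is still at least [t / 2 (D1 delta) ^ 2]. For [g = 2] there is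
    no nonzero vector of sum zero, so [D2] obeys only the weaker bound and the block, which has a
    single variable, is summed directly. *)

(** * Taylor inequalities for sine, cosine and the exponential *)

Lemma is_derive_ge0 (R : realType) (f f' : R -> R) :
  (forall x : R, is_derive x 1 f (f' x)) -> (forall x, 0 <= x -> 0 <= f' x) ->
  f 0 = 0 -> forall x, 0 <= x -> 0 <= f x.
Proof.
move=> fd f'0 f0 x x0.
have cf : {within `[0, x], continuous f}.
  by apply: derivable_within_continuous => y _; have [] := fd y.
have [c /[!in_itv]/= /andP[c0 _]] := MVT_segment x0 (fun y _ => fd y) cf.
by rewrite f0 !subr0 => ->; rewrite mulr_ge0 ?f'0.
Qed.

Lemma sin_le_id (R : realType) (x : R) : 0 <= x -> sin x <= x.
Proof.
move=> x0; rewrite -subr_ge0.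
apply: (@is_derive_ge0 _ (fun x => x - sin x) (fun x => 1 - cos x)) x0.
- by move=> y; rewrite subr_ge0 cos_le1.
- by rewrite sin0 subr0.
Qed.

(** This integrates [sin_le_id] from [0]; each later sine or cosine inequality integrates the
    previous one, and evenness covers negative [x]. *)
Lemma cos_ge_quadratic (R : realType) (x : R) : 1 - x ^+ 2 / 2 <= cos x.
Proof.
suff H (y : R) : 0 <= y -> 0 <= cos y - 1 + y ^+ 2 / 2.
  by have := H `|x| (normr_ge0 _); rewrite cos_norm real_normK ?num_real//; lra.
apply: (@is_derive_ge0 _ (fun x => cos x - 1 + x ^+ 2 / 2) (fun x => x - sin x)).
- by move=> z; apply: is_derive_eq; rewrite /GRing.scale/=; lra.
- by move=> z z0; rewrite subr_ge0 sin_le_id.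
- by rewrite cos0; lra.
Qed.

Lemma sin_ge_cubic (R : realType) (x : R) : 0 <= x -> x - x ^+ 3 / 6 <= sin x.
Proof.
move=> x0; suff : 0 <= sin x - x + x ^+ 3 / 6 by lra.
apply: (@is_derive_ge0 _ (fun x => sin x - x + x ^+ 3 / 6)
  (fun x => cos x - 1 + x ^+ 2 / 2)) x0.
- by move=> z; apply: is_derive_eq; rewrite /GRing.scale/=; lra.
- by move=> z z0; have := cos_ge_quadratic z; lra.
- by rewrite sin0; lra.
Qed.

Lemma sin_sub_id_le (R : realType) (x : R) : `|sin x - x| <= `|x| ^+ 3 / 6.
Proof.
have H (y : R) : 0 <= y -> `|sin y - y| <= y ^+ 3 / 6.
  by move=> y0; have := sin_ge_cubic y0; have := sin_le_id y0; rewrite ler_norml; lra.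
have [x0|x0] := leP 0 x; first by rewrite (ger0_norm x0) H.
by have := H (- x); rewrite sinN -opprD normrN (ltr0_norm x0); apply; lra.
Qed.

Lemma cos_le_quartic (R : realType) (x : R) :
  cos x <= 1 - x ^+ 2 / 2 + x ^+ 4 / 24.
Proof.
suff H (y : R) : 0 <= y -> 0 <= 1 - y ^+ 2 / 2 + y ^+ 4 / 24 - cos y.
  have := H `|x| (normr_ge0 _); rewrite cos_norm (exprM _ 2 2) real_normK ?num_real//.
  by rewrite -exprM; lra.
apply: (@is_derive_ge0 _ (fun x => 1 - x ^+ 2 / 2 + x ^+ 4 / 24 - cos x)
  (fun x => sin x - x + x ^+ 3 / 6)).
- by move=> z; apply: is_derive_eq; rewrite /GRing.scale/=; lra.
- by move=> z z0; have := sin_ge_cubic z0; lra.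
- by rewrite cos0; lra.
Qed.

Lemma expRN_le_quadratic (R : realType) (x : R) : 0 <= x ->
  expR (- x) <= 1 - x + x ^+ 2 / 2.
Proof.
move=> x0; suff : 0 <= 1 - x + x ^+ 2 / 2 - expR (- x) by lra.
apply: (@is_derive_ge0 _ (fun x => 1 - x + x ^+ 2 / 2 - expR (- x))
  (fun x => - 1 + x + expR (- x))) x0.
- by move=> z; apply: is_derive_eq; rewrite /GRing.scale/=; lra.
- by move=> z z0; have := expR_ge1Dx (- z); lra.
- by rewrite oppr0 expR0; lra.
Qed.

(** * Gaussian integrals *)

Lemma is_derive_mean_value (R : realType) (f f' : R -> R) (a b : R) :
  (forall x : R, is_derive x 1 f (f' x)) -> a < b ->
  exists c, [/\ a < c, c < b & f b - f a = f' c * (b - a)].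
Proof.
move=> fd ab; have cf : {within `[a, b], continuous f}.
  by apply: derivable_within_continuous => y _; have [] := fd y.
have [c /[!in_itv]/= /andP[ac cb] E] := MVT ab (fun y _ => fd y) cf.
by exists c.
Qed.

(* Such an [f] increases and then decreases, from [f 0 = 0] to the limit [0]. *)
Lemma unimodal_ge0 (R : realType) (f k e e' m : R -> R) :
  (forall x : R, is_derive x 1 f (e x * k x)) ->
  (forall x : R, is_derive x 1 k (e' x * m x)) ->
  (forall x, 0 < e x) -> (forall x, 0 < e' x) ->
  (forall x y, 0 <= x -> x <= y -> m y <= m x) ->
  f 0 = 0 -> k 0 = 0 -> f x @[x --> +oo] --> 0 ->
  forall x, 0 <= x -> 0 <= f x.
Proof.
move=> fd kd e0 e'0 mm f0 k0 fy x x0; rewrite leNgt; apply/negP => fx.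
have {}x0 : 0 < x.
  by rewrite lt_neqAle x0 andbT; apply: contraTneq fx => <-; rewrite f0 ltxx.
have [y xy fxy] : exists2 y, x < y & f x < f y.
  have nfx : 0 < - f x by rewrite oppr_gt0.
  have /cvgrPdist_lt/(_ _ nfx) H := fy.
  near (pinfty_nbhs R) => y; exists y; first by near: y; apply: nbhs_pinfty_gt; rewrite num_real.
  have : `|0 - f y| < - f x by near: y.
  by rewrite sub0r normrN ltr_norml opprK => /andP[].
have [c [c0 cx]] := is_derive_mean_value fd x0.
have [d [xd dy]] := is_derive_mean_value fd xy.
rewrite f0 subr0 subr0 => Ed Ec.
have kc : k c < 0.
  by rewrite -(pmulr_rlt0 _ (e0 c)) -(pmulr_llt0 _ x0) -Ec.
have kd0 : 0 < k d.
  rewrite -(pmulr_rgt0 _ (e0 d)) -(@pmulr_lgt0 _ (y - x)) ?subr_gt0// -Ed.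
  by rewrite subr_gt0.
have cd : c < d by apply: lt_trans cx xd.
have [a [a0 ac]] := is_derive_mean_value kd c0.
have [b [cb bd]] := is_derive_mean_value kd cd.
rewrite k0 !subr0 => Eb Ea.
have ma : m a < 0.
  by rewrite -(pmulr_rlt0 _ (e'0 a)) -(pmulr_llt0 _ c0) -Ea.
have mb : 0 < m b.
  rewrite -(pmulr_rgt0 _ (e'0 b)) -(@pmulr_lgt0 _ (d - c)) ?subr_gt0// -Eb.
  by rewrite subr_gt0 (lt_trans kc).
have := mm a b (ltW a0) (ltW (lt_trans ac cb)); lra.
Unshelve. all: by end_near. Qed.

Section gauss_primitive.
Variable R : realType.
Notation mu := (@lebesgue_measure R).

Definition gauss_cumulative (x : R) : R := \int[mu]_(t in `]-oo, x]) gauss_fun t.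

Lemma is_derive_gauss_cumulative (x : R) :
  is_derive x 1 gauss_cumulative (expR (- x ^+ 2)).
Proof.
have xx1 : x < x + 1 by rewrite ltrDl.
have fi : mu.-integrable [set` Interval -oo%O (BRight (x + 1))] (EFin \o gauss_fun).
  by apply: (integrableS measurableT) => //; exact: integrableT_gauss.
have [dJ EJ] : derivable gauss_cumulative x 1 /\ derive1 gauss_cumulative x = gauss_fun x.
  exact: (continuous_FTC1 xx1 fi (ltNyr x) (@continuous_gauss_fun R x)).
split; first exact: dJ.
by rewrite -derive1E EJ.
Qed.

(** The integral of [exp (- u ^ 2)] from [0] to [x]; going through the cumulative function makes it
    odd and differentiable on the whole line. *)
Definition gauss_primitive (x : R) : R :=
  (gauss_cumulative x - gauss_cumulative (- x)) / 2.
Notation G := gauss_primitive.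

Lemma is_derive_gauss_primitive (x : R) : is_derive x 1 G (expR (- x ^+ 2)).
Proof.
have d1 : is_derive x 1 (gauss_cumulative \o -%R) (expR (- x ^+ 2) * -1).
  have dJ := is_derive_gauss_cumulative (- x); rewrite sqrrN in dJ.
  have dN : is_derive x 1 (-%R : R -> R) (-1).
    exact: (@is_deriveN _ _ _ id x 1 1 (is_derive_id x 1)).
  exact: (is_derive1_comp dJ dN).
have dJ := is_derive_gauss_cumulative x.
have H : is_derive x 1
    ((gauss_cumulative - (gauss_cumulative \o -%R)) * cst 2^-1) (expR (- x ^+ 2)).
  by apply: is_derive_eq; rewrite /GRing.scale/= /cst; lra.
exact: H.
Qed.

Lemma gauss_primitiveN (x : R) : G (- x) = - G x.
Proof. by rewrite /G opprK; lra. Qed.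

Lemma gauss_primitive0 : G 0 = 0.
Proof. by have := gauss_primitiveN 0; rewrite oppr0; lra. Qed.

(** Both sides vanish at [0] and have the same derivative. The identification gives access to the
    limit [pi / 4] of the square. *)
Lemma gauss_primitive_integral (x : R) : 0 < x ->
  G x = gauss_integral_proof.integral0_gauss x.
Proof.
move=> x0; set I := gauss_integral_proof.integral0_gauss.
have fi (y : R) : mu.-integrable `[0, y] (EFin \o gauss_fun).
  by apply: (integrableS measurableT) => //; exact: integrableT_gauss.
have dH (y : R) : y \in `]0, x[ -> is_derive y 1 (G - I) ((fun=> 0) y).
  rewrite in_itv/= => /andP[y0 yx].
  have [dI EI] : derivable I y 1 /\ derive1 I y = gauss_fun y.
    exact: (continuous_FTC1_closed yx (fi x) y0 (@continuous_gauss_fun R y)).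
  have dI' : is_derive y 1 I (expR (- y ^+ 2)).
    split; first exact: dI.
    by rewrite -derive1E EI.
  have dG := is_derive_gauss_primitive y.
  by apply: is_derive_eq; rewrite subrr.
have cH : {within `[0, x], continuous (G - I)}.
  move=> y; apply: continuousB.
    apply: derivable_within_continuous => z _.
    by have [] := is_derive_gauss_primitive z.
  exact: (parameterized_integral_continuous (ltW x0) (fi x)).
have [c _] := MVT x0 dH cH.
have I0 : I 0 = 0 by rewrite /I /gauss_integral_proof.integral0_gauss set_itv1 Rintegral_set1.
rewrite mul0r -![(G - I) _]/(G _ - I _) I0 gauss_primitive0; lra.
Qed.

Lemma cvg_gauss_primitive_sqr : G x ^+ 2 @[x --> +oo] --> pi / 4.
Proof.
apply: cvg_trans (@gauss_integral_proof.cvg_integral0_gauss_sqr R).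
apply: near_eq_cvg; near=> x.
rewrite gauss_primitive_integral//; near: x.
Unshelve. all: by end_near. Qed.

Lemma cvg_expRN_sqr (c : R) : 1 <= c -> expR (- (c * x ^+ 2)) @[x --> +oo] --> 0.
Proof.
move=> c1; apply: (@squeeze_cvgr _ _ _ _ (cst 0) gauss_fun).
- near=> x; rewrite expR_ge0 ler_expR lerN2 ler_peMl ?sqr_ge0//.
- exact: cvg_cst.
- exact: cvg_gauss_fun.
Unshelve. all: by end_near. Qed.

(** In polar coordinates: a square of half-side [x] contains the disc of radius [x]. The proof stays
    one-dimensional: the difference has derivative [2 exp (- x ^ 2) (G x - pi x / 4)], and the
    derivative of the last factor decreases. *)
Lemma gauss_primitive_sqr_ge (x : R) : 0 <= x ->
  pi / 4 * (1 - expR (- x ^+ 2)) <= G x ^+ 2.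
Proof.
move=> x0; rewrite -subr_ge0; set f := fun x => G x ^+ 2 - pi / 4 * (1 - expR (- x ^+ 2)).
apply: (@unimodal_ge0 R f (fun x => G x - pi / 4 * x) (fun x => 2 * expR (- x ^+ 2))
   (fun=> 1) (fun x => expR (- x ^+ 2) - pi / 4)) x0 => {x}.
- move=> x; have dG := is_derive_gauss_primitive x.
  by apply: is_derive_eq; rewrite /GRing.scale/=; ring.
- move=> x; have dG := is_derive_gauss_primitive x.
  by apply: is_derive_eq; rewrite /GRing.scale/=; ring.
- by move=> x; rewrite mulr_gt0 ?expR_gt0.
- by [].
- move=> x y x0 xy; rewrite lerD2r ler_expR lerN2 ler_pXn2r// nnegrE//.
  exact: le_trans xy.
- by rewrite /f gauss_primitive0 expr0n/= oppr0 expR0; lra.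
- by rewrite gauss_primitive0; lra.
- have -> : 0 = pi / 4 - pi / 4 * (1 - 0) :> R by lra.
  apply: cvgB; first exact: cvg_gauss_primitive_sqr.
  apply: cvgM; first exact: cvg_cst.
  by apply: cvgB; [exact: cvg_cst|exact: cvg_gauss_fun].
Qed.

(** The circumscribed disc, of radius [sqrt 2 x], accounts for the [2] in the exponent. *)
Lemma gauss_primitive_sqr_le (x : R) : 0 <= x ->
  G x ^+ 2 <= pi / 4 * (1 - expR (- (2 * x ^+ 2))).
Proof.
move=> x0; rewrite -subr_ge0; set f := fun x => pi / 4 * (1 - expR (- (2 * x ^+ 2))) - G x ^+ 2.
apply: (@unimodal_ge0 R f (fun x => pi * x * expR (- x ^+ 2) - 2 * G x)
  (fun x => expR (- x ^+ 2)) (fun x => expR (- x ^+ 2))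
  (fun x => pi * (1 - 2 * x ^+ 2) - 2)) x0 => {x}.
- move=> x; have dG := is_derive_gauss_primitive x.
  apply: is_derive_eq; rewrite /GRing.scale/=.
  by rewrite (_ : - (2 * x ^+ 2) = - x ^+ 2 + - x ^+ 2) ?expRD; [field|ring].
- move=> x; have dG := is_derive_gauss_primitive x.
  by apply: is_derive_eq; rewrite /GRing.scale/=; ring.
- by move=> x; rewrite expR_gt0.
- by move=> x; rewrite expR_gt0.
- move=> x y x0 xy; rewrite lerD2r ler_wpM2l ?pi_ge0// lerD2l lerN2 ler_pM2l//.
  by rewrite ler_pXn2r// nnegrE//; exact: le_trans xy.
- by rewrite /f gauss_primitive0 expr0n/= mulr0 oppr0 expR0; lra.
- by rewrite gauss_primitive0; lra.
- have -> : 0 = pi / 4 * (1 - 0) - pi / 4 :> R by lra.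
  apply: cvgB; last exact: cvg_gauss_primitive_sqr.
  apply: cvgM; first exact: cvg_cst.
  by apply: cvgB; [exact: cvg_cst|apply: cvg_expRN_sqr; lra].
Qed.

End gauss_primitive.

(** * Riemann sums of one-dimensional Gaussians *)

Section riemann_gauss.
Variable R : realType.
Implicit Types (s h mu delta x y : R) (m n : nat).

Lemma is_derive_mull s x : is_derive x 1 ( *%R s) s.
Proof.
have H : is_derive x 1 (s *: (id : R -> R)) s.
  by apply: is_derive_eq; rewrite /GRing.scale/= mulr1.
exact: H.
Qed.

(** The integral of [exp (- (s u) ^ 2)] over [u] from [0] to [x], for [s] nonzero. *)
Let F s x : R := gauss_primitive (s * x) / s.

Let is_derive_F s x : s != 0 -> is_derive x 1 (F s) (expR (- (s * x) ^+ 2)).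
Proof.
move=> s0; have dG := is_derive_gauss_primitive (s * x).
have dM := is_derive_mull s x.
have dc := is_derive1_comp dG dM.
have H : is_derive x 1 ((@gauss_primitive R \o *%R s) * cst s^-1) (expR (- (s * x) ^+ 2)).
  by apply: is_derive_eq; rewrite /GRing.scale/= /cst; field.
exact: H.
Qed.

Let F_nd s x y : s != 0 -> x <= y -> F s x <= F s y.
Proof.
move=> s0; rewrite le_eqVlt => /predU1P[->//|xy].
have [c [_ _ E]] := is_derive_mean_value (fun x => is_derive_F x s0) xy.
by rewrite -subr_ge0 E mulr_ge0 ?expR_ge0// subr_ge0 ltW.
Qed.

Let F_lip s x y : s != 0 -> x <= y -> F s y <= F s x + (y - x).
Proof.
move=> s0; rewrite le_eqVlt => /predU1P[->|xy]; first by lra.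
have [c [_ _ E]] := is_derive_mean_value (fun x => is_derive_F x s0) xy.
suff : F s y - F s x <= y - x by lra.
by rewrite E ler_piMl ?subr_ge0 ?(ltW xy)// expR_le1 oppr_le0 sqr_ge0.
Qed.

Let F_odd s x : F s (- x) = - F s x.
Proof. by rewrite /F mulrN gauss_primitiveN mulNr. Qed.

Let F0 s : F s 0 = 0.
Proof. by rewrite /F mulr0 gauss_primitive0 mul0r. Qed.

(** Among the translates of an interval the centred one has the largest Gaussian mass. This makes
    the upper Riemann bound uniform in [mu]. *)
Let F_sym_le s b mu : s != 0 -> 0 <= b -> F s (b - mu) + F s (b + mu) <= 2 * F s b.
Proof.
move=> s0 b0; wlog mu0 : mu / 0 <= mu.
  move=> H; have [/H//|mu0] := leP 0 mu.
  by have := H (- mu); rewrite opprK oppr_ge0 addrC => /(_ (ltW mu0)).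
rewrite -subr_ge0.
apply: (@is_derive_ge0 R (fun mu => 2 * F s b - (F s (b - mu) + F s (b + mu)))
  (fun mu => expR (- (s * (b - mu)) ^+ 2) - expR (- (s * (b + mu)) ^+ 2))) mu0.
- move=> x.
  have d1 : is_derive x 1 (fun x => b - x : R) (-1).
    by apply: is_derive_eq; rewrite add0r; exact: mul1r.
  have d2 : is_derive x 1 (fun x => b + x : R) 1.
    have H : is_derive x 1 (cst b + id : R -> R) 1 by apply: is_derive_eq; exact: add0r.
    exact: H.
  have c1 := @is_derive1_comp R (F s) (fun x => b - x) x _ _ (is_derive_F (b - x) s0) d1.
  have c2 := @is_derive1_comp R (F s) (fun x => b + x) x _ _ (is_derive_F (b + x) s0) d2.
  rewrite mulr1 mulrN1 in c1 c2.
  have H : is_derive x 1 (cst (2 * F s b) -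
      ((F s \o (fun x => b - x)) + (F s \o (fun x => b + x))))
     (expR (- (s * (b - x)) ^+ 2) - expR (- (s * (b + x)) ^+ 2)).
    by apply: is_derive_eq; ring.
  exact: H.
- move=> x x0; rewrite subr_ge0 ler_expR lerN2 !exprMn ler_wpM2l ?sqr_ge0//.
  rewrite -subr_ge0 (_ : _ - _ = 4 * (b * x)); last by ring.
  by rewrite mulr_ge0// mulr_ge0.
- by rewrite subr0 addr0; lra.
Qed.

(** The derivative has size [2 s |u| exp (- u ^ 2)] with [u = s c], and
    [|u| <= 1 + u ^ 2 <= exp (u ^ 2)]. *)
Let gauss_lip s x y : 0 < s -> x < y ->
  `|expR (- (s * x) ^+ 2) - expR (- (s * y) ^+ 2)| <= 2 * s * (y - x).
Proof.
move=> s0 xy.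
have dE (z : R) : is_derive z 1 (fun z => expR (- (s * z) ^+ 2))
    (- (2 * s * (s * z)) * expR (- (s * z) ^+ 2)).
  have dM := is_derive_mull s z.
  have dS : is_derive z 1 (fun z => - (s * z) ^+ 2) (- (2 * s * (s * z))).
    have H : is_derive z 1 (- ( *%R s) ^+ 2) (- (2 * s * (s * z))).
      by apply: is_derive_eq; rewrite /GRing.scale/=; ring.
    exact: H.
  have dc := @is_derive1_comp R expR (fun z => - (s * z) ^+ 2) z _ _ (is_derive_expR (- (s * z) ^+ 2)) dS.
  have -> : - (2 * s * (s * z)) * expR (- (s * z) ^+ 2) =
    expR (- (s * z) ^+ 2) * (- (2 * s * (s * z))) by rewrite mulrC.
  exact: dc.
have [c [_ _ E]] := is_derive_mean_value dE xy.
rewrite distrC E normrM (gtr0_norm (_ : 0 < y - x)) ?subr_gt0//.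
rewrite ler_pM2r ?subr_gt0// normrM normrN normrM (gtr0_norm (expR_gt0 _)).
rewrite (gtr0_norm (_ : 0 < 2 * s)) ?mulr_gt0// -mulrA ler_piMr ?mulr_ge0 ?(ltW s0)//.
set u := s * c; rewrite expRN ler_pdivrMr ?expR_gt0// mul1r.
apply: le_trans (expR_ge1Dx _).
have := sqr_ge0 (`|u| - 1); have := normr_ge0 u.
rewrite -[in X in _ <= 1 + X](real_normK (num_real u)); nra.
Qed.

Lemma riemann_gauss_error s h a n : 0 < s -> 0 < h ->
  `|h * \sum_(j < n) expR (- (s * (h * j%:R - a)) ^+ 2)
    - (F s (h * n%:R - a) - F s (- a))| <= n%:R * h * (2 * s * h).
Proof.
move=> s0 h0; elim: n => [|n IH].
  by rewrite big_ord0 !mulr0 !sub0r subrr oppr0 normr0 !mul0r.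
rewrite big_ord_recr/= mulrDr -natr1 (mulrDr h n%:R) (mulr1 h).
set y := h * n%:R - a; rewrite (_ : h * n%:R + h - a = y + h); last by rewrite /y; ring.
have yh : y < y + h by rewrite ltrDl.
have s1 : s != 0 by rewrite gt_eqF.
have [c [yc ch E]] := is_derive_mean_value (fun x => is_derive_F x s1) yh.
set S := h * \sum_(_ < _) _ in IH *.
have -> : S + h * expR (- (s * y) ^+ 2) - (F s (y + h) - F s (- a)) =
  (S - (F s y - F s (- a))) + (h * expR (- (s * y) ^+ 2) - (F s (y + h) - F s y)) by ring.
have /= lip := gauss_lip s0 yc.
rewrite [leRHS](_ : _ = n%:R * h * (2 * s * h) + h * (2 * s * h)); last by ring.
rewrite (le_trans (ler_normD _ _))// lerD//.
rewrite E (_ : y + h - y = h); last by ring.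
rewrite mulrC -mulrBl normrM (gtr0_norm h0) mulrC ler_pM2l//.
apply: le_trans lip _; rewrite ler_pM2l ?mulr_gt0//; lra.
Qed.

Let F_le s x : 0 < s -> 0 <= x ->
  F s x <= Num.sqrt (pi / 4 * (1 - expR (- (2 * (s * x) ^+ 2)))) / s.
Proof.
move=> s0 x0; rewrite /F ler_pM2r ?invr_gt0//.
have sx : 0 <= s * x by rewrite mulr_ge0// ltW.
apply: le_trans (ler_norm _) _; rewrite -sqrtr_sqr ler_wsqrtr//.
exact: gauss_primitive_sqr_le.
Qed.

Let F_ge s x : 0 < s -> 0 <= x ->
  Num.sqrt (pi / 4 * (1 - expR (- (s * x) ^+ 2))) / s <= F s x.
Proof.
move=> s0 x0; rewrite ler_pdivrMr//.
have sx : 0 <= s * x by rewrite mulr_ge0// ltW.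
have Fx : 0 <= F s x * s.
  by rewrite mulr_ge0 ?(ltW s0)// -(F0 s) F_nd// gt_eqF.
rewrite -(ger0_norm Fx) -sqrtr_sqr ler_wsqrtr// /F mulfVK ?gt_eqF//.
exact: gauss_primitive_sqr_ge.
Qed.

Let riemann_error_le s h delta m : 0 < s -> 0 < h -> h <= 1 -> m%:R * h <= delta ->
  (2 * m%:R + 1) * h * (2 * s * h) <= h * ((2 * delta + 1) * (2 * s)).
Proof.
move=> s0 h0 h1 mh.
have -> : (2 * m%:R + 1) * h * (2 * s * h) = h * (((2 * m%:R + 1) * h) * (2 * s)) by ring.
by rewrite ler_pM2l// ler_pM2r ?mulr_gt0//; lra.
Qed.

Lemma riemann_gauss_le s h mu delta m : 0 < s -> 0 < h -> h <= 1 ->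
  0 <= delta -> m%:R * h <= delta ->
  h * \sum_(j < (2 * m).+1) expR (- (s * (h * (j%:R - m%:R) - mu)) ^+ 2) <=
  2 / s * Num.sqrt (pi / 4 * (1 - expR (- (2 * (s * delta) ^+ 2))))
  + h * (2 + (2 * delta + 1) * (2 * s)).
Proof.
move=> s0 h0 h1 d0 mh; have s1 : s != 0 by rewrite gt_eqF.
have hm0 : 0 <= h * m%:R by rewrite mulr_ge0// ltW.
(* The [2 m + 1] cells cover [[- m h, (m + 1) h]] shifted by [- mu]. [E1] adds one cell on the left
   so that the interval is symmetric before the shift; [E4] pays [h] per side for exceeding
   [delta]. *)
have E1 : F s (h * m%:R + mu) <= F s (h * m%:R + h + mu).
  by apply: F_nd => //; rewrite lerD2r lerDl ltW.
have E2 := F_sym_le mu s1 (addr_ge0 hm0 (ltW h0)).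
have E3 : F s (h * m%:R + h) <= F s (delta + h).
  by apply: F_nd => //; rewrite lerD2r mulrC.
have E4 : F s (delta + h) <= F s delta + (delta + h - delta).
  by apply: F_lip => //; rewrite lerDl ltW.
have E5 := F_le s0 d0.
have E6 := riemann_error_le s0 h0 h1 mh.
have := riemann_gauss_error (h * m%:R + mu) (2 * m).+1 s0 h0.
have shift (j : nat) : h * j%:R - (h * m%:R + mu) = h * (j%:R - m%:R) - mu by ring.
under eq_bigr do rewrite shift.
rewrite -natr1 natrM (_ : h * (2 * m%:R + 1) - (h * m%:R + mu) = h * m%:R + h - mu); last by ring.
rewrite F_odd opprK ler_norml => /andP[_].
set q := Num.sqrt _ in E5 *.
have -> : 2 / s * q + h * (2 + (2 * delta + 1) * (2 * s)) =
  2 * (q / s) + 2 * h + h * ((2 * delta + 1) * (2 * s)) by ring.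
move: E1 E2 E3 E4 E5 E6; set S := h * \sum_(_ < _) _.
move: (h * ((2 * delta + 1) * (2 * s))) ((2 * m%:R + 1) * h * (2 * s * h)) (q / s) S.
move: (F s (h * m%:R + mu)) (F s (h * m%:R + h + mu)) (F s (h * m%:R + h - mu)).
move: (F s (h * m%:R + h)) (F s (delta + h)) (F s delta).
by clear; move=> *; lra.
Qed.

Lemma riemann_gauss_ge s h delta m : 0 < s -> 0 < h -> h <= 1 ->
  0 <= delta -> m%:R * h <= delta -> delta <= (m%:R + 1) * h ->
  2 / s * Num.sqrt (pi / 4 * (1 - expR (- (s * delta) ^+ 2)))
  - h * (2 + (2 * delta + 1) * (2 * s)) <=
  h * \sum_(j < (2 * m).+1) expR (- (s * (h * (j%:R - m%:R))) ^+ 2).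
Proof.
move=> s0 h0 h1 d0 mh mh'; have s1 : s != 0 by rewrite gt_eqF.
(* On the right the cells reach [(m + 1) h >= delta]; on the left they stop at [m h], which costs at
   most [h]. *)
have E1 : F s (h * m%:R + h) <= F s (h * m%:R) + (h * m%:R + h - h * m%:R).
  by apply: F_lip => //; rewrite lerDl ltW.
have E3 : F s delta <= F s (h * m%:R + h).
  by apply: F_nd => //; move: mh'; rewrite mulrDl mul1r mulrC.
have E5 := F_ge s0 d0.
have E6 := riemann_error_le s0 h0 h1 mh.
have := riemann_gauss_error (h * m%:R) (2 * m).+1 s0 h0.
under eq_bigr do rewrite -mulrBr.
rewrite -natr1 natrM (_ : h * (2 * m%:R + 1) - (h * m%:R) = h * m%:R + h); last by ring.
rewrite F_odd opprK ler_norml => /andP[+ _].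
set q := Num.sqrt _ in E5 *.
have -> : 2 / s * q - h * (2 + (2 * delta + 1) * (2 * s)) =
  2 * (q / s) - 2 * h - h * ((2 * delta + 1) * (2 * s)) by ring.
move: E1 E3 E5 E6 h0; set S := h * \sum_(_ < _) _.
move: (h * ((2 * delta + 1) * (2 * s))) ((2 * m%:R + 1) * h * (2 * s * h)) (q / s) S.
move: (F s (h * m%:R)) (F s (h * m%:R + h)) (F s delta) (h * m%:R).
by clear; move=> *; lra.
Qed.

End riemann_gauss.

(** * Gaussian sums over one block through mixtures of normal densities *)

Lemma expR_sum_fin (R : realType) (I : finType) (F : I -> R) :
  expR (\sum_i F i) = \prod_i expR (F i).
Proof. by rewrite (big_morph expR (@expRD R) (@expR0 R)). Qed.

(** Every density has mass one, so integrating the pointwise inequality leaves the weights. This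
    removes the auxiliary variable [xi] after an estimate at each of its values. *)
Lemma normal_mixture_le (R : realType) (I J : finType)
    (a m s : I -> R) (b p q : J -> R) :
  (forall i, 0 <= a i) -> (forall j, 0 <= b j) ->
  (forall xi, \sum_i a i * normal_pdf (m i) (s i) xi <=
              \sum_j b j * normal_pdf (p j) (q j) xi) ->
  \sum_i a i <= \sum_j b j.
Proof.
move=> a0 b0 le_ab.
pose mix (K : finType) (c u v : K -> R) (xi : R) : \bar R :=
  (\sum_k (c k)%:E * (normal_pdf (u k) (v k) xi)%:E)%E.
have mterm (K : finType) (c u v : K -> R) k : measurable_fun setT
    (fun xi : R => ((c k)%:E * (normal_pdf (u k) (v k) xi)%:E : \bar R)%E).
  apply: measurable_funeM; apply/measurable_EFinP; exact: measurable_normal_pdf.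
have mmix (K : finType) (c u v : K -> R) : measurable_fun setT (mix K c u v).
  by apply: emeasurable_sum => k; exact: mterm.
have mix0 (K : finType) (c u v : K -> R) (xi : R) : (forall k, 0 <= c k) ->
    (0 <= mix K c u v xi)%E.
  by move=> c0; apply: sume_ge0 => k _; rewrite mule_ge0 ?lee_fin ?normal_pdf_ge0.
have int_mix (K : finType) (c u v : K -> R) : (forall k, 0 <= c k) ->
    (\int[lebesgue_measure]_xi mix K c u v xi = (\sum_k c k)%:E)%E.
  move=> c0; have t0 k (xi : R) : setT xi ->
      (0 <= (c k)%:E * (normal_pdf (u k) (v k) xi)%:E)%E.
    by move=> _; rewrite mule_ge0 ?lee_fin ?normal_pdf_ge0.
  rewrite (ge0_integral_sum lebesgue_measure measurableT (mterm K c u v) t0).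
  rewrite -sumEFin; apply: eq_bigr => k _.
  rewrite ge0_integralZl ?lee_fin//; first by rewrite integral_normal_pdf mule1.
    by apply/measurable_EFinP; exact: measurable_normal_pdf.
  by move=> xi _; rewrite lee_fin normal_pdf_ge0.
rewrite -lee_fin -(int_mix _ a m s a0) -(int_mix _ b p q b0).
have Q := (@ge0_le_integral _ _ R lebesgue_measure _ measurableT _ _ (fun xi _ => mix0 _ a m s xi a0) (mmix _ a m s) (mmix _ b p q)).
apply: Q => xi _.
have H := le_ab xi.
by rewrite /mix -lee_fin -!sumEFin in H *.
Qed.

Section block.
Variables (R : realType) (A T : finType) (r : R) (x : T -> R).
Let g : R := #|A|.+1%:R.
Let g0 : 0 < g. Proof. by rewrite ltr0n. Qed.

(** For [r ^ 2 = t / g ^ 2] and [#|A| = g - 1] this is [exp (- t y^T M y / 2)], with [M] restricted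
    to one pair. *)
Definition block_weight (y : A -> R) : R :=
  expR (- (r ^+ 2 / 2) * (#|A|.+1%:R * (\sum_a y a ^+ 2) - (\sum_a y a) ^+ 2)).

Let profile (xi : R) : R := \sum_j expR (- (g / 2) * (r * x j - xi / g) ^+ 2).

Lemma normal_pdf1E (m xi : R) :
  normal_pdf m 1 xi = normal_peak 1 * expR (- (xi - m) ^+ 2 / 2).
Proof. by rewrite normal_pdfE ?oner_neq0// /normal_fun expr1n. Qed.

Lemma normal_pdf_sqrtE (m v xi : R) : 0 < v ->
  normal_pdf m (Num.sqrt v) xi =
  normal_peak 1 / Num.sqrt v * expR (- (xi - m) ^+ 2 / (2 * v)).
Proof.
move=> v0; rewrite normal_pdfE; last by rewrite gt_eqF// sqrtr_gt0.
rewrite /normal_fun /normal_peak sqr_sqrtr ?(ltW v0)// expr1n mul1r -mulrnAr.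
rewrite sqrtrM ?(ltW v0)// invfM (mulrC (Num.sqrt v)^-1); congr (_ * expR (_ / _)).
by rewrite mulr_natl.
Qed.

(* The Hubbard-Stratonovich trick: the rank one term [(\sum_a y a) ^+ 2] is
   linearised by an auxiliary Gaussian variable [xi], after which the
   coordinates decouple. *)
Let hubbard_stratonovich (xi : R) :
  \sum_(v : {ffun A -> T}) block_weight (x \o v) *
     normal_pdf (r * \sum_a x (v a)) 1 xi =
  Num.sqrt g * normal_pdf 0 (Num.sqrt g) xi * profile xi ^+ #|A|.
Proof.
rewrite /profile -prodr_const bigA_distr_bigA/= mulr_sumr; apply: eq_bigr => v _.
rewrite normal_pdf1E normal_pdf_sqrtE// -expR_sum_fin /block_weight [LHS]mulrC -[LHS]mulrA -expRD.
rewrite (_ : Num.sqrt g * _ = normal_peak 1 * expR (- (xi - 0) ^+ 2 / (2 * g))); last first.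
  by field; rewrite gt_eqF// sqrtr_gt0.
rewrite -[RHS]mulrA -expRD; congr (_ * expR _).
rewrite -mulr_sumr.
have -> : \sum_i (r * x (v i) - xi / g) ^+ 2 =
    r ^+ 2 * \sum_i x (v i) ^+ 2 - 2 * r * (xi / g) * \sum_i x (v i) +
    (g - 1) * (xi / g) ^+ 2.
  rewrite !mulr_sumr -sumrB (_ : (g - 1) * _ = \sum_(i : A) (xi / g) ^+ 2); last first.
    by rewrite sumr_const -mulr_natl /g -natr1; congr (_ * _); ring.
  by rewrite -big_split/=; apply: eq_bigr => i _; ring.
rewrite -/g /=; field; by rewrite gt_eqF.
Qed.

(** The left side of [hubbard_stratonovich] is a mixture of total weight the block sum; once
    [profile] is replaced by [K], its right side is a multiple of one normal density. *)
Lemma block_sum_le (K : R) : (forall xi, profile xi <= K) ->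
  \sum_(v : {ffun A -> T}) block_weight (x \o v) <= Num.sqrt g * K ^+ #|A|.
Proof.
move=> PK; have P0 xi : 0 <= profile xi by apply: sumr_ge0 => j _; exact: expR_ge0.
have K0 : 0 <= K := le_trans (P0 0) (PK 0).
have := @normal_mixture_le R {ffun A -> T} unit (fun v => block_weight (x \o v))
  (fun v => r * \sum_a x (v a)) (fun=> 1) (fun=> Num.sqrt g * K ^+ #|A|)
  (fun=> 0) (fun=> Num.sqrt g).
rewrite [X in _ -> _ -> _ -> _ <= X]big_const card_unit/= addr0; apply.
- by move=> v; exact: expR_ge0.
- by move=> _; rewrite mulr_ge0 ?sqrtr_ge0 ?exprn_ge0.
- move=> xi; rewrite hubbard_stratonovich big_const card_unit/= addr0 mulrAC.
  apply: ler_wpM2r; first exact: normal_pdf_ge0.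
  apply: ler_wpM2l; first exact: sqrtr_ge0.
  by apply: lerXn2r; rewrite ?nnegrE ?P0 ?K0 ?PK.
Qed.

Let tangent_line (y q : R) n : 0 <= y -> 0 <= q ->
  q ^+ n + n%:R * q ^+ n.-1 * (y - q) <= y ^+ n.
Proof.
move=> y0 q0; case: n => [|n]; first by rewrite !mul0r addr0.
elim: n => [|n IH]; first by rewrite /= !expr1 expr0; lra.
have := ler_wpM2l y0 IH; rewrite /= -exprS; apply: le_trans.
have : 0 <= n.+1%:R * q ^+ n * (y - q) ^+ 2 by rewrite mulr_ge0 ?sqr_ge0 ?mulr_ge0 ?exprn_ge0.
rewrite (exprS q n.+1) (exprS q n) -[n.+2%:R]natr1; move: (n.+1%:R) (q ^+ n) => c d; nra.
Qed.

(* Jensen's inequality for [y ^ n], as the tangent line at the mean [q] of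
   [profile]. *)
Lemma block_sum_ge :
  Num.sqrt g * (\sum_j expR (- (g / 4) * (r * x j) ^+ 2) / Num.sqrt 2) ^+ #|A| <=
  \sum_(v : {ffun A -> T}) block_weight (x \o v).
Proof.
set c := fun j => expR (- (g / 4) * (r * x j) ^+ 2) / Num.sqrt 2.
have c0 j : 0 <= c j by rewrite divr_ge0 ?expR_ge0 ?sqrtr_ge0.
set q := \sum_j _; have q0 : 0 <= q by exact: sumr_ge0.
set n := #|A|; set G := Num.sqrt g.
have G0 : 0 <= G by exact: sqrtr_ge0.
have Gn0 : 0 <= G * (n%:R * q ^+ n.-1) by rewrite !mulr_ge0 ?exprn_ge0.
set k := G * (n%:R * q ^+ n.-1).
(* Mixture weights must be nonnegative, so the subtracted term [n q ^ n] of the tangent line moves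
   to the other side, as the extra component of [b]. *)
pose a (i : unit + T) := match i with inl _ => G * q ^+ n | inr j => k * c j end.
pose am (i : unit + T) := match i with inl _ => 0 | inr j => g * r * x j / 2 end.
pose ad (i : unit + T) := match i with inl _ => G | inr _ => Num.sqrt (g / 2) end.
pose b (i : {ffun A -> T} + unit) :=
  match i with inl v => block_weight (x \o v) | inr _ => k * q end.
pose bm (i : {ffun A -> T} + unit) :=
  match i with inl v => r * \sum_a x (v a) | inr _ => 0 end.
pose bd (i : {ffun A -> T} + unit) := match i with inl _ => 1 | inr _ => G end.
have unitE (F : unit -> R) : \sum_i F i = F tt.
  by rewrite (bigD1 tt)//= big1 ?addr0//; case.
suff : \sum_i a i <= \sum_i b i.
  by rewrite !big_sumType/= !unitE -mulr_sumr -/q lerD2r.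
apply: (@normal_mixture_le R _ _ a am ad b bm bd).
- by case=> [_|j] /=; rewrite mulr_ge0 ?exprn_ge0.
- by case=> [v|_] /=; [exact: expR_ge0|rewrite mulr_ge0].
move=> xi; rewrite !big_sumType/= hubbard_stratonovich !unitE.
(* Completing the square in the density of variance [g] times one term of [profile] gives variance
   [g / 2]. This is the origin of the exponent [g / 4] and the factor [1 / sqrt 2] in [c], and it
   makes [q] the mean of [profile]. *)
have E : \sum_j k * c j *
      normal_pdf (g * r * x j / 2) (Num.sqrt (g / 2)) xi =
    G * normal_pdf 0 G xi * (n%:R * q ^+ n.-1 * profile xi).
  rewrite /profile !mulr_sumr; apply: eq_bigr => j _.
  rewrite /k /c !normal_pdf_sqrtE//; last by rewrite divr_gt0.
  rewrite sqrtrM ?(ltW g0)// sqrtrV// -/G.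
  have G1 : G != 0 by rewrite gt_eqF// sqrtr_gt0.
  have S2 : Num.sqrt 2 != 0 :> R by rewrite gt_eqF// sqrtr_gt0.
  rewrite (_ : _ * _ = G * (n%:R * q ^+ n.-1) * (normal_peak 1 / G) *
    (expR (- (g / 4) * (r * x j) ^+ 2) * expR (- (xi - g * r * x j / 2) ^+ 2 / (2 * (g / 2))))); last first.
    by field; rewrite G1 S2.
  rewrite [RHS](_ : _ = G * (n%:R * q ^+ n.-1) * (normal_peak 1 / G) *
    (expR (- (xi - 0) ^+ 2 / (2 * g)) * expR (- (g / 2) * (r * x j - xi / g) ^+ 2))); last by ring.
  by rewrite -!expRD; congr (_ * expR _); field; rewrite gt_eqF.
rewrite E; have := tangent_line #|A| (sumr_ge0 _ (fun j _ => expR_ge0 _) : 0 <= profile xi) q0.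
rewrite -/n => tl.
have Gp0 : 0 <= G * normal_pdf 0 G xi by rewrite mulr_ge0 ?normal_pdf_ge0.
have := ler_wpM2l Gp0 tl; rewrite -/G /k; lra.
Qed.

End block.

(* [field] would look through the definition of [pi]. *)
Ltac field_pi :=
  match goal with |- context [@pi ?R] =>
    move: (pi_gt0 R); generalize (@pi R); move=> ? ?; field; rewrite !gt_eqF//
  end.

(** * Two-sided bounds for the block sum over the grid *)

Definition grid_point (R : realType) (N m : nat) (j : 'I_(2 * m).+1) : R :=
  2 * pi / N%:R * (j%:R - m%:R).

Section block_bounds.
Variables (R : realType) (A : finType) (g : nat) (t delta : R).
Hypotheses (g2 : (1 < g)%N) (cardA : #|A| = g.-1) (t0 : 0 < t) (delta0 : 0 < delta).
Let r : R := Num.sqrt t / g%:R.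
Let g0 : 0 < g%:R :> R. Proof. by rewrite ltr0n ltnW. Qed.
Let cardA1 : #|A|.+1 = g. Proof. by rewrite cardA prednK// ltnW. Qed.
Let r0 : 0 < r. Proof. by rewrite divr_gt0// sqrtr_gt0. Qed.
Let r2E : r ^+ 2 = t / g%:R ^+ 2.
Proof. by rewrite /r expr_div_n sqr_sqrtr// ltW. Qed.
Let gridsum N m :=
  \sum_(v : {ffun A -> 'I_(2 * m).+1}) @block_weight R A r (@grid_point R N m \o v).

Let const_factor (c s : R) : 0 < s -> 0 <= c ->
  (2 * pi)^-1 * (2 / s * Num.sqrt (pi / 4 * c)) =
  Num.sqrt ((4 * pi * s ^+ 2)^-1) * Num.sqrt c.
Proof.
move=> s0 c0; have pi0 := pi_gt0 R.
have q0 : 0 <= (2 * pi)^-1 * (2 / s).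
  by rewrite mulr_ge0 ?invr_ge0 ?divr_ge0 ?mulr_ge0 ?(ltW pi0) ?(ltW s0).
have q1 : 0 <= (4 * pi * s ^+ 2)^-1.
  by rewrite invr_ge0 mulr_ge0 ?sqr_ge0// mulr_ge0 ?(ltW pi0).
rewrite mulrA -(ger0_norm q0) -sqrtr_sqr -(sqrtrM _ (sqr_ge0 _)) -(sqrtrM _ q1).
by congr Num.sqrt; field_pi.
Qed.

Let Npos N : 0 < N%:R :> R -> 0 < 2 * pi / N%:R :> R.
Proof. by move=> N0; rewrite divr_gt0// mulr_gt0// pi_gt0. Qed.

(** For [g > 2], [profile] is bounded with [s ^ 2 = t / (2 g)], and the circumscribed disc doubles
    the exponent to [t delta ^ 2 / g]. For [g = 2] this would be [t delta ^ 2 / 2], which the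
    condition on [E] does not allow; the single variable is then summed directly, with
    [s ^ 2 = t / 8]. *)
Lemma block_upper (E : R) : ((2 < g)%N -> t * delta ^+ 2 / g%:R <= E) ->
  (g = 2%N -> t * delta ^+ 2 / 4 <= E) ->
  exists2 C : R, 0 <= C & forall N m, 0 < N%:R :> R -> 2 * pi / N%:R <= 1 :> R ->
    m%:R * (2 * pi / N%:R) <= delta ->
    gridsum N m / N%:R ^+ g.-1 <= Num.sqrt g%:R *
      (Num.sqrt (g%:R / (2 * pi * t)) * Num.sqrt (1 - expR (- E)) + C / N%:R) ^+ g.-1.
Proof.
move=> E3 E2; have pi0 := pi_gt0 R.
have monoE (a b c : R) : 0 <= c -> a <= b ->
    c * Num.sqrt (1 - expR (- a)) <= c * Num.sqrt (1 - expR (- b)).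
  by move=> c0 ab; rewrite ler_wpM2l// ler_wsqrtr// lerD2l lerN2 ler_expR lerN2.
have [|] := ltnP 2 g; last first.
  move=> gle2; have gE : g = 2%N by apply/eqP; rewrite eqn_leq gle2.
  have A1 : #|A| = 1%N by rewrite cardA gE.
  have /fintype1P[a aE] : #|A| == 1%N by rewrite A1.
  pose s := Num.sqrt (t / 8); have s0 : 0 < s by rewrite sqrtr_gt0 divr_gt0.
  have s2 : s ^+ 2 = t / 8 by rewrite sqr_sqrtr// divr_ge0// ltW.
  pose C := 2 + (2 * delta + 1) * (2 * s).
  have C0 : 0 <= C by rewrite addr_ge0// mulr_ge0 ?addr_ge0 ?mulr_ge0// ltW.
  exists C => // N m N0 h1 mh; have h0 := Npos N0.
  have -> : gridsum N m =
      \sum_(j < (2 * m).+1) expR (- (s * (2 * pi / N%:R * (j%:R - m%:R) - 0)) ^+ 2).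
    rewrite /gridsum (reindex (fun j => [ffun=> j] : {ffun A -> 'I_(2 * m).+1}))/=; last first.
      exists (fun v : {ffun A -> 'I_(2 * m).+1} => v a).
        by move=> j _; rewrite ffunE.
      by move=> v _; apply/ffunP => b; rewrite ffunE (aE b).
    apply: eq_bigr => j _; rewrite /block_weight.
    rewrite [\sum_(i : A) _](bigD1 a)//= big1; last by move=> b /eqP[]; exact: aE.
    rewrite [\sum_(i : A) grid_point _ _ _](bigD1 a)//= big1; last first.
      by move=> b /eqP[]; exact: aE.
    rewrite ffunE !addr0 A1 r2E [X in _ = expR (- X)]exprMn s2 gE /grid_point subr0.
    by congr expR; field; rewrite gt_eqF.
  have := @riemann_gauss_le R s _ 0 delta m s0 h0 h1 (ltW delta0) mh.
  rewrite -/C gE /= !expr1; set S := \sum_(_ < _) _ => H.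
  have H' := ler_wpM2l (_ : 0 <= (2 * pi)^-1) H.
  have {H'} := H' (ltW _); rewrite invr_gt0 mulr_gt0// => /(_ isT).
  rewrite (_ : (2 * pi)^-1 * (2 * pi / N%:R * S) = S / N%:R); last by field_pi.
  move=> /le_trans; apply.
  rewrite mulrDr const_factor//; last by rewrite subr_ge0 expR_le1 oppr_le0 mulr_ge0 ?sqr_ge0.
  rewrite [leRHS]mulrDr lerD//.
    rewrite [leRHS]mulrA -[X in _ <= X * _](sqrtrM _ (ler0n R 2)) exprMn s2.
    rewrite (_ : 2%:R * (2%:R / (2 * pi * t)) = (4 * pi * (t / 8))^-1); last by field_pi.
    rewrite monoE ?sqrtr_ge0//; apply: le_trans (E2 gE); lra.
  rewrite (_ : (2 * pi)^-1 * _ = C / N%:R); last by field_pi.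
  rewrite ler_peMl ?divr_ge0// ?(ltW N0)//.
  rewrite -[leLHS]sqrtr1 ler_wsqrtr//; lra.
move=> g3; have {}E3 := E3 g3.
pose s := Num.sqrt (t / (2 * g%:R)); have s0 : 0 < s by rewrite sqrtr_gt0 divr_gt0// mulr_gt0.
have s2 : s ^+ 2 = t / (2 * g%:R) by rewrite sqr_sqrtr// divr_ge0// ?mulr_ge0 ltW.
pose C := 2 + (2 * delta + 1) * (2 * s).
have C0 : 0 <= C by rewrite addr_ge0// mulr_ge0 ?addr_ge0 ?mulr_ge0// ltW.
exists C => // N m N0 h1 mh; have h0 := Npos N0.
set B := Num.sqrt (g%:R / _) * _; rewrite ler_pdivrMr ?exprn_gt0// -mulrA -exprMn -cardA.
rewrite -[in X in Num.sqrt X]cardA1; apply: block_sum_le => xi.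
rewrite cardA1 mulrDl mulfVK ?gt_eqF//.
have := @riemann_gauss_le R s _ (xi / (g%:R * r)) delta m s0 h0 h1 (ltW delta0) mh.
rewrite -/C; under eq_bigr => j _.
  rewrite (_ : - _ = - (g%:R / 2) * (r * grid_point R N j - xi / g%:R) ^+ 2); last first.
    rewrite exprMn s2 /grid_point; set z := 2 * pi / _ * _.
    rewrite (_ : r * z - xi / g%:R = r * (z - xi / (g%:R * r))); last first.
      by field; rewrite !gt_eqF.
    by rewrite exprMn r2E; field; rewrite !gt_eqF.
  over.
set S := \sum_(_ < _) _ => H.
have : (2 * pi)^-1 * (2 * pi / N%:R * S) <= B + C / N%:R.
  apply: le_trans (ler_wpM2l _ H) _; first by rewrite invr_ge0 mulr_ge0 ?ltW.
  rewrite mulrDr const_factor//; last by rewrite subr_ge0 expR_le1 oppr_le0 mulr_ge0 ?sqr_ge0.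
  apply: lerD; last first.
    by rewrite (_ : (2 * pi)^-1 * _ = C / N%:R)//; field_pi.
  rewrite /B exprMn s2 (_ : (4 * pi * _)^-1 = g%:R / (2 * pi * t)); last first.
    by field_pi.
  rewrite monoE ?sqrtr_ge0//; apply: le_trans E3.
  by rewrite (_ : 2 * _ = t * delta ^+ 2 / g%:R)//; field; rewrite gt_eqF.
rewrite (_ : (2 * pi)^-1 * _ = S / N%:R); last by field_pi.
by rewrite ler_pdivrMr// mulrDl mulfVK ?gt_eqF.
Qed.

(** The exponent [g / 4] in [block_sum_ge] gives [s ^ 2 = t / (4 g)], and the inscribed disc keeps
    it. The factor [1 / sqrt 2] there cancels against [1 / s], larger by [sqrt 2] than in the upper
    bound. *)
Lemma block_lower (E : R) : E <= t * delta ^+ 2 / (4 * g%:R) ->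
  exists2 C : R, 0 <= C & forall N m, 0 < N%:R :> R -> 2 * pi / N%:R <= 1 :> R ->
    m%:R * (2 * pi / N%:R) <= delta -> delta <= (m%:R + 1) * (2 * pi / N%:R) ->
    0 <= Num.sqrt (g%:R / (2 * pi * t)) * Num.sqrt (1 - expR (- E)) - C / N%:R ->
    Num.sqrt g%:R *
      (Num.sqrt (g%:R / (2 * pi * t)) * Num.sqrt (1 - expR (- E)) - C / N%:R) ^+ g.-1
    <= gridsum N m / N%:R ^+ g.-1.
Proof.
move=> Ele; have pi0 := pi_gt0 R.
pose s := Num.sqrt (t / (4 * g%:R)); have s0 : 0 < s by rewrite sqrtr_gt0 divr_gt0// mulr_gt0.
have s2 : s ^+ 2 = t / (4 * g%:R) by rewrite sqr_sqrtr// divr_ge0// ?mulr_ge0 ltW.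
pose C := 2 + (2 * delta + 1) * (2 * s).
have C0 : 0 <= C by rewrite addr_ge0// mulr_ge0 ?addr_ge0 ?mulr_ge0// ltW.
exists C => // N m N0 h1 mh mh'; have h0 := Npos N0.
set B := Num.sqrt (g%:R / _) * _ => BC; rewrite ler_pdivlMr ?exprn_gt0// -mulrA -exprMn -cardA.
rewrite -[in X in Num.sqrt X]cardA1; apply: le_trans (block_sum_ge _ _ _).
rewrite cardA1 ler_wpM2l ?sqrtr_ge0//.
have S20 : 0 < Num.sqrt 2 :> R by rewrite sqrtr_gt0.
apply: lerXn2r; rewrite ?nnegrE.
- by rewrite mulr_ge0// ltW.
- by apply: sumr_ge0 => j _; rewrite divr_ge0 ?expR_ge0 ?ltW.
have := @riemann_gauss_ge R s _ delta m s0 h0 h1 (ltW delta0) mh mh'.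
rewrite -/C; under [in leRHS]eq_bigr => j _.
  rewrite (_ : - _ = - (g%:R / 4) * (r * grid_point R N j) ^+ 2); last first.
    rewrite [(s * _) ^+ 2]exprMn s2 [(r * _) ^+ 2]exprMn r2E /grid_point; set z := 2 * pi / _ * _.
    by field; rewrite !gt_eqF.
  over.
rewrite -mulr_suml; set S := \sum_(_ < _) _ => H.
rewrite -ler_pdivlMr//.
have HS : B * Num.sqrt 2 - C / N%:R <= S / N%:R.
  have := ler_wpM2l (_ : 0 <= (2 * pi)^-1) H.
  rewrite invr_ge0 mulr_ge0 ?(ltW pi0)// => /(_ isT).
  rewrite (_ : (2 * pi)^-1 * (2 * pi / N%:R * S) = S / N%:R); last by field_pi.
  apply: le_trans.
  rewrite mulrBr const_factor//; last by rewrite subr_ge0 expR_le1 oppr_le0 sqr_ge0.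
  apply: lerB; last first.
    by rewrite (_ : (2 * pi)^-1 * _ = C / N%:R)//; field_pi.
  have q0 : 0 <= g%:R / (2 * pi * t).
    by rewrite divr_ge0 ?mulr_ge0 ?(ltW g0) ?(ltW pi0) ?(ltW t0).
  rewrite /B mulrAC -(sqrtrM _ q0) exprMn s2 (_ : (4 * pi * _)^-1 = g%:R / (2 * pi * t) * 2); last first.
    by field_pi.
  rewrite ler_wpM2l ?sqrtr_ge0// ler_wsqrtr// lerD2l lerN2 ler_expR lerN2.
  apply: le_trans Ele _.
  by rewrite (_ : t / _ * _ = t * delta ^+ 2 / (4 * g%:R))//; field; rewrite gt_eqF.
have -> : S / Num.sqrt 2 / N%:R = S / N%:R / Num.sqrt 2 by rewrite mulrAC.
rewrite ler_pdivlMr//; apply: le_trans HS; rewrite mulrBl lerB// ler_peMr ?divr_ge0 ?(ltW N0)//.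
rewrite -[leLHS]sqrtr1 ler_wsqrtr//; lra.
Qed.

End block_bounds.

(** * Coordinates and the constants [D1], [D2] *)

Definition pairs (k : nat) : finType := {p : 'I_k * 'I_k | (p.1 < p.2)%N}.
Definition nonzero_residue (g : nat) : finType := {a : 'I_g | nat_of_ord a != 0%N}.

Lemma card_pairs k : #|pairs k| = 'C(k, 2).
Proof.
rewrite card_sig -bin2_sum -sum1_card.
rewrite (eq_bigl (fun p : 'I_k * 'I_k => (p.1 < p.2)%N)); last by move=> p; rewrite inE.
rewrite -(pair_big_dep xpredT (fun i j : 'I_k => (i < j)%N) (fun _ _ => 1%N))/=.
rewrite (exchange_big_dep xpredT)//= big_mkord; apply: eq_bigr => j _.
by rewrite (big_ord_narrow (ltnW (ltn_ord j))) sum_nat_const card_ord muln1.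
Qed.

Lemma card_nonzero_residue g : #|nonzero_residue g| = g.-1.
Proof.
case: g => [|g]; first by apply: eq_card0 => -[[]].
rewrite card_sig; transitivity #|predC1 (ord0 : 'I_g.+1)|; first exact: eq_card.
by rewrite cardC1 card_ord.
Qed.

Section coordinates.
Variables (k g : nat).

Definition mkcoord (p : pairs k) (a : nonzero_residue g) : coord k g :=
  exist _ (val p, val a) (introT andP (conj (valP p) (valP a))).
Definition coord_pair (c : coord k g) : pairs k :=
  exist _ (val c).1 (proj1 (andP (valP c))).
Definition coord_residue (c : coord k g) : nonzero_residue g :=
  exist _ (val c).2 (proj2 (andP (valP c))).

Lemma mkcoordK c : mkcoord (coord_pair c) (coord_residue c) = c.
Proof. by case: c => [[p a] H]; exact: val_inj. Qed.
Lemma coord_pairK p a : coord_pair (mkcoord p a) = p.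
Proof. exact: val_inj. Qed.
Lemma coord_residueK p a : coord_residue (mkcoord p a) = a.
Proof. exact: val_inj. Qed.

Lemma big_coord (S : Type) (idx : S) (op : Monoid.com_law idx) (F : coord k g -> S) :
  \big[op/idx]_c F c = \big[op/idx]_p \big[op/idx]_a F (mkcoord p a).
Proof.
rewrite pair_big (reindex (fun u : pairs k * nonzero_residue g => mkcoord u.1 u.2))//=.
exists (fun c => (coord_pair c, coord_residue c)) => [[p a] _|c _] /=.
  by rewrite coord_pairK coord_residueK.
exact: mkcoordK.
Qed.

Lemma card_coord : #|coord k g| = dimd k g.
Proof.
rewrite -sum1_card big_coord/= sum_nat_const big_const iter_addn addn0 mul1n.
by rewrite card_pairs card_nonzero_residue /dimd subn1.
Qed.

Lemma MmatE (R : realType) p a q b :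
  Mmat R (mkcoord p a) (mkcoord q b) =
  if p == q then (a == b)%:R / g%:R - (g%:R ^+ 2)^-1 else 0.
Proof.
rewrite /Mmat /= !val_eqE; case: eqP => // _; case: eqP => _; last by rewrite mul0r sub0r.
have g0 : g%:R != 0 :> R by rewrite pnatr_eq0 -lt0n (leq_trans _ (ltn_ord (val a))).
by rewrite (_ : true%:R = 1)//; field.
Qed.

Lemma MmatM (R : realType) p a (nu : coord k g -> R) :
  \sum_c Mmat R (mkcoord p a) c * nu c =
  nu (mkcoord p a) / g%:R - (g%:R ^+ 2)^-1 * \sum_b nu (mkcoord p b).
Proof.
rewrite big_coord/= (bigD1 p)//= [X in _ + X]big1 ?addr0; last first.
  move=> q qp; apply: big1 => b _; rewrite MmatE eq_sym (negbTE qp) mul0r//.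
under eq_bigr do rewrite MmatE eqxx mulrBl; rewrite sumrB -mulr_sumr; congr (_ - _).
rewrite (bigD1 a)//= big1 ?addr0 ?eqxx ?mul1r 1?mulrC// => b ba.
by rewrite eq_sym (negbTE ba) !mul0r.
Qed.

End coordinates.

Section constants.
Variables (R : realType) (k g : nat) (D1 D2 : R).
Hypotheses (g2 : (1 < g)%N) (k2 : (1 < k)%N) (D10 : 0 < D1) (D20 : 0 < D2).
Hypothesis good : good_constants k g D1 D2.
Let g0 : 0 < g%:R :> R. Proof. by rewrite ltr0n ltnW. Qed.
Let p0 : pairs k := exist _ (Ordinal (ltnW k2), Ordinal k2) isT.
Let a1 : nonzero_residue g := exist _ (Ordinal g2) isT.

Let PPM (P : coord k g -> coord k g -> R) (nu : coord k g -> R) c :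
  (forall c c', \sum_l P c l * P l c' = Mmat R c c') ->
  \sum_l P c l * (\sum_m P l m * nu m) = \sum_m Mmat R c m * nu m.
Proof.
move=> PP; under [RHS]eq_bigr do rewrite -PP mulr_suml.
by rewrite exchange_big/=; apply: eq_bigr => l _; rewrite mulr_sumr;
  apply: eq_bigr => m _; rewrite mulrA.
Qed.

(** Using the inner inclusion twice writes the constant vector [D1 ^ 2] as [M nu] with [nu] in the
    unit cube. On a pair, [M] divides the sum of the entries by [g ^ 2], and the entries of [nu] are
    at most [1]. *)
Lemma good_constants_D1 : D1 ^+ 2 <= (g%:R ^+ 2)^-1.
Proof.
case: good => P [_ [PP /(_ 1 ltr01)[inP _]]].
rewrite mulr1 in inP.
have [|mu [mu1 muE]] := inP (fun=> D1); first by move=> _; rewrite gtr0_norm.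
have [|nu [nu1 nuE]] := inP (fun c => D1 * mu c).
  by move=> c; rewrite normrM (gtr0_norm D10) ler_piMr// ltW.
have E c : \sum_m Mmat R c m * nu m = D1 ^+ 2.
  rewrite -(PPM _ _ PP); under eq_bigr do rewrite -nuE mulrCA.
  by rewrite -mulr_sumr -muE.
have : \sum_(a : nonzero_residue g) D1 ^+ 2 =
    (g%:R ^+ 2)^-1 * \sum_a nu (mkcoord p0 a).
  under eq_bigr => a _ do rewrite -(E (mkcoord p0 a)) MmatM.
  rewrite sumrB -mulr_suml sumr_const card_nonzero_residue -[X in _ - X]mulr_natl.
  rewrite -subn1 natrB ?(ltnW g2)//; field; by rewrite gt_eqF.
rewrite sumr_const card_nonzero_residue -[X in X = _]mulr_natl => S.
have n0 : 0 < g.-1%:R :> R by rewrite ltr0n -ltnS prednK// ltnW.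
rewrite -(ler_pM2l n0) S mulrC ler_pM2r ?invr_gt0 ?exprn_gt0//.
apply: le_trans (ler_sum _ _) _.
  by move=> a _; apply: le_trans (ler_norm _) (nu1 _).
by rewrite sumr_const card_nonzero_residue.
Qed.

Let D2_bound (nu : coord k g -> R) c : (forall c, `|nu c| <= 1) ->
  `|\sum_m Mmat R c m * nu m| <= D2 ^+ 2.
Proof.
move=> nu1; case: good => P [_ [PP H]].
rewrite -(PPM _ _ PP) expr2; apply: (H D2 D20).2 => l.
by have := (H 1 ltr01).2 nu nu1 l; rewrite mulr1.
Qed.

(** Applying [P] twice sends the unit cube into the cube of half-side [D2 ^ 2]. The test vector [nu]
    has sum zero on its pair, hence eigenvalue [1 / g]; it takes two distinct nonzero residues. *)
Lemma good_constants_D2 : (2 < g)%N -> g%:R^-1 <= D2 ^+ 2.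
Proof.
move=> g3; pose a2 : nonzero_residue g := exist _ (Ordinal g3) isT.
pose nu c : R := (c == mkcoord p0 a1)%:R - (c == mkcoord p0 a2)%:R.
have inj a b : (mkcoord p0 a == mkcoord p0 b) = (a == b).
  apply/eqP/eqP => [H|->//].
  by rewrite -(coord_residueK p0 a) H coord_residueK.
apply: le_trans (D2_bound (nu := nu) (mkcoord p0 a1) _); last first.
  by move=> c; rewrite /nu; do 2 case: eqP => _; rewrite ?subr0 ?sub0r ?subrr ?normrN ?normr1 ?normr0.
rewrite MmatM /nu; under eq_bigr do rewrite !inj.
rewrite sumrB !inj eqxx (_ : (a1 == a2) = false)// subr0.
rewrite (bigD1 a1)//= ?eqxx big1 ?addr0; last by move=> b /negbTE ->.
rewrite (bigD1 a2)//= ?eqxx big1 ?addr0; last by move=> b /negbTE ->.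
by rewrite subrr mulr0 subr0 mul1r ler_norm.
Qed.

(** With one nonzero residue the block of [M] is the number [1 / 4]. *)
Lemma good_constants_D2_two : g = 2%N -> 4^-1 <= D2 ^+ 2.
Proof.
move=> gE; apply: le_trans (D2_bound (nu := fun=> 1) (mkcoord p0 a1) _); last first.
  by move=> c; rewrite normr1.
rewrite MmatM sumr_const card_nonzero_residue; apply: le_trans (ler_norm _).
by rewrite gE /= mulr1n; lra.
Qed.

End constants.

(** * Exponential sums *)

Section expi.
Variable R : realType.
Implicit Types (a b x y : R) (z w : R[i]) (n : nat) (l : int).

Definition expi a : R[i] := (cos a +i* sin a)%C.

Lemma expi0 : expi 0 = 1.
Proof. by rewrite /expi cos0 sin0. Qed.

Lemma expiD a b : expi (a + b) = expi a * expi b.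
Proof.
by apply/eqP; rewrite eq_complex/= cosD sinD (addrC (sin a * _)) !eqxx.
Qed.

Lemma expi_sum (I : finType) (F : I -> R) : expi (\sum_i F i) = \prod_i expi (F i).
Proof. by rewrite (big_morph expi expiD expi0). Qed.

Lemma expiMn a n : expi (a *+ n) = expi a ^+ n.
Proof. by elim: n => [|n IH]; rewrite ?expi0// mulrS exprS expiD IH. Qed.

Lemma normc_expi a : normc (expi a) = 1.
Proof. by rewrite /normc/= cos2Dsin2 sqrtr1. Qed.

Lemma expi_2pi : expi (2 * pi) = 1.
Proof. by rewrite (_ : 2 * pi = pi *+ 2) ?mulr_natl// /expi cos2pi sin2pi. Qed.

Lemma expi_2pi_int l : expi (2 * pi * l%:~R) = 1.
Proof.
have P n : expi (2 * pi * n%:R) = 1 by rewrite mulr_natr expiMn expi_2pi expr1n.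
case: (intP l) => [|n|n]; first by rewrite mulr0 expi0.
  exact: P.
have := expiD (2 * pi * (- n.+1%:Z)%:~R) (2 * pi * n.+1%:R).
by rewrite P mulr1 mulrNz mulrN addNr expi0 => <-.
Qed.

Lemma expi_neq1 a : 0 < `|a| < 2 * pi -> expi a != 1.
Proof.
move=> /andP[a0 a2]; apply/eqP => /(congr1 (@complex.Re R))/= E.
have : 0 < sin (`|a| / 2) by apply: sin_gt0_pi; lra.
have : cos `|a| = 1 by rewrite cos_norm.
set u := `|a| / 2; rewrite (_ : `|a| = u *+ 2) ?cos_mulr2n; last by rewrite mulr2n /u; lra.
by have := cos2Dsin2 u; rewrite mulr2n; nra.
Qed.

Lemma Re_sum (I : Type) (r : seq I) (P : pred I) (F : I -> R[i]) :
  complex.Re (\sum_(i <- r | P i) F i) = \sum_(i <- r | P i) complex.Re (F i).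
Proof. by apply: (big_morph (@complex.Re R)) => // -[a b] [c d]. Qed.

Lemma Im_sum (I : Type) (r : seq I) (P : pred I) (F : I -> R[i]) :
  complex.Im (\sum_(i <- r | P i) F i) = \sum_(i <- r | P i) complex.Im (F i).
Proof. by apply: (big_morph (@complex.Im R)) => // -[a b] [c d]. Qed.

Lemma normc_sum (I : Type) (r : seq I) (P : pred I) (F : I -> R[i]) :
  normc (\sum_(i <- r | P i) F i) <= \sum_(i <- r | P i) normc (F i).
Proof.
elim/big_ind2 : _ => // [|a b c d ab cd]; first by rewrite normc0.
by apply: le_trans (le_normcD _ _) _; exact: lerD.
Qed.

Lemma normcX z n : normc (z ^+ n) = normc z ^+ n.
Proof. by elim: n => [|n IH]; rewrite ?normc1// !exprS normcM IH. Qed.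

Lemma normc_ge0 z : 0 <= normc z.
Proof. by case: z => a b; exact: sqrtr_ge0. Qed.

Lemma Re_le_normc z : `|complex.Re z| <= normc z.
Proof.
by case: z => a b /=; rewrite -sqrtr_sqr ler_wsqrtr// lerDl sqr_ge0.
Qed.

(** For [u] different from [v] this is a geometric sum whose ratio is an [N]-th root of unity, and
    not [1] because [|u - v| < N]. *)
Lemma sum_expi_roots (N u v : nat) : (u < N)%N -> (v < N)%N ->
  \sum_(j < N) expi (2 * pi / N%:R * j%:R * (u%:R - v%:R)) =
  ((if u == v then N%:R else 0)%:C)%C.
Proof.
move=> uN vN; have N0 : 0 < N%:R :> R by rewrite ltr0n (leq_ltn_trans _ uN).
have [->|uv] := eqVneq u v.
  under eq_bigr do rewrite subrr mulr0 expi0.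
  by rewrite sumr_const card_ord; apply/esym; exact: (rmorph_nat (real_complex R)).
pose w := expi (2 * pi / N%:R * (u%:R - v%:R)).
under eq_bigr => j _ do rewrite mulrAC mulr_natr expiMn -/w.
have wN : w ^+ N = 1.
  rewrite /w -expiMn -(expi_2pi_int (u%:Z - v%:Z)); congr expi.
  by rewrite -[LHS]mulr_natr intrB; field_pi.
have w1 : w != 1.
  apply: expi_neq1; have pi0 := pi_gt0 R.
  have c0 : 0 < 2 * pi / N%:R :> R by rewrite divr_gt0// mulr_gt0.
  rewrite normrM (gtr0_norm c0); apply/andP; split.
    by rewrite mulr_gt0// normr_gt0 subr_eq0 eqr_nat.
  rewrite -ltr_pdivlMl// (_ : _^-1 * _ = N%:R); last by field_pi.
  rewrite ltr_norml.
  have := ler0n R u; have := ler0n R v.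
  move: uN vN; rewrite -(ltr_nat R) -(ltr_nat R v); lra.
have := subrX1 w N; rewrite wN subrr => /esym/eqP.
by rewrite mulf_eq0 subr_eq0 (negbTE w1)/= => /eqP.
Qed.

End expi.

(** * The characteristic function near zero *)

Lemma powR_half_natmul (R : realType) (a : R) n : 0 <= a ->
  a `^ (n%:R / 2) = Num.sqrt a ^+ n.
Proof.
by move=> a0; rewrite mulrC powRrM powR12_sqrt// powR_mulrn// sqrtr_ge0.
Qed.

(** The imaginary part controls the loss of the real part at each step, and the upper bound on the
    real part controls the growth of the imaginary one, so all three bounds go through the induction
    together. *)
Lemma Re_oneDi_expn (R : realType) (b : R) n : n%:R * `|b| <= 1 ->
  1 - (n%:R * b) ^+ 2 <= complex.Re ((1 +i* b)%C ^+ n).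
Proof.
move=> nb.
suff [] : [/\ 1 - (n%:R * b) ^+ 2 <= complex.Re ((1 +i* b)%C ^+ n),
    complex.Re ((1 +i* b)%C ^+ n) <= 1 + (n%:R * b) ^+ 2 &
    `|complex.Im ((1 +i* b)%C ^+ n)| <= 2 * (n%:R * `|b|)] by [].
elim: n nb => [|n IH] nb.
  by rewrite expr0 !mul0r expr0n/= normr0 mulr0 subr0 addr0.
have nb' : n%:R * `|b| <= 1.
  by apply: le_trans nb; rewrite ler_wpM2r// ler_nat.
have [] := IH nb'; rewrite (exprS (1 +i* b)%C n); case: ((1 +i* b)%C ^+ n) => u v /= H1 H2 H3.
rewrite !mul1r -natr1; rewrite -natr1 in nb.
have b2 : `|b| ^+ 2 = b ^+ 2 by rewrite real_normK ?num_real.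
have n0 := ler0n R n; have b0 := normr_ge0 b.
have bv : `|b * v| <= 2 * n%:R * b ^+ 2.
  by rewrite normrM -b2; nra.
have un : `|u| <= 2.
  have : (n%:R * b) ^+ 2 <= 1 by rewrite exprMn -b2 -exprMn exprn_ile1// mulr_ge0.
  rewrite ler_norml; lra.
have [/andP[bv1 bv2]] : - (2 * n%:R * b ^+ 2) <= b * v <= 2 * n%:R * b ^+ 2.
  by rewrite -ler_norml.
have bb := sqr_ge0 b.
split; [nra|nra|].
apply: le_trans (ler_normD _ _) _; rewrite normrM.
have : `|b| * `|u| <= `|b| * 2 by rewrite ler_wpM2l.
nra.
Qed.

Section local.
Variables (R : realType) (X : finType) (Y : X -> R) (D : R).
Hypotheses (D0 : 0 <= D) (D1 : D <= 10^-1).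
Hypotheses (YD : forall x, `|Y x| <= D) (EY : \sum_x Y x = 0).
Let n : R := #|X|%:R.
Hypothesis n0 : 0 < n.
(** [Y] plays the phase at a uniform point: [q] is its variance and [A + i B] its characteristic
    function. *)
Let q : R := (\sum_x Y x ^+ 2) / n.
Let A : R := (\sum_x cos (Y x)) / n.
Let B : R := (\sum_x sin (Y x)) / n.
Let S : R[i] := \sum_x expi (Y x).

Let avg_le (F : X -> R) (c : R) : (forall x, F x <= c) -> (\sum_x F x) / n <= c.
Proof.
move=> Fc; rewrite ler_pdivrMr//; apply: le_trans (ler_sum _ (fun x _ => Fc x)) _.
by rewrite sumr_const -[leLHS]mulr_natr.
Qed.

Let Y2 x : Y x ^+ 2 <= D ^+ 2.
Proof. by rewrite -(real_normK (num_real (Y x))) lerXn2r// nnegrE. Qed.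

Let q_ge0 : 0 <= q.
Proof. by rewrite divr_ge0 ?(ltW n0)// sumr_ge0// => x _; exact: sqr_ge0. Qed.

Let q_le : q <= D ^+ 2. Proof. exact: avg_le. Qed.

Let D2 : D ^+ 2 <= 100^-1.
Proof. by rewrite (le_trans (_ : _ <= 10^-1 ^+ 2)) ?lerXn2r ?nnegrE//; lra. Qed.

Let A_ge : 1 - q / 2 <= A.
Proof.
have : \sum_x (1 - Y x ^+ 2 / 2) <= \sum_x cos (Y x).
  by apply: ler_sum => x _; exact: cos_ge_quadratic.
rewrite sumrB -mulr_suml sumr_const => H.
rewrite /A ler_pdivlMr// /q; apply: le_trans H.
by rewrite mulrBl mul1r mulrAC divfK ?gt_eqF.
Qed.

Let A_le : A <= 1 - q / 2 + D ^+ 4 / 24.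
Proof.
have : \sum_x cos (Y x) <= \sum_x (1 - Y x ^+ 2 / 2 + D ^+ 4 / 24).
  apply: ler_sum => x _; apply: le_trans (cos_le_quartic _) _.
  rewrite lerD2l ler_pM2r ?invr_gt0// (exprM _ 2 2) (exprM _ 2 2).
  by rewrite lerXn2r// nnegrE sqr_ge0.
rewrite !big_split/= sumrN -mulr_suml !sumr_const => H.
rewrite /A ler_pdivrMr// /q; apply: le_trans H _.
rewrite -[X in _ + X]mulr_natr -/n !mulrDl mul1r mulNr; set s := \sum_x _.
by rewrite (_ : s / n / 2 * n = s / 2)//; field; rewrite gt_eqF.
Qed.

(** The mean of [Y] is zero, so the linear term of the sine drops out and [B] is of third order; its
    square produces the sixth powers. *)
Let B_le : `|B| <= D ^+ 3 / 6.
Proof.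
rewrite /B normrM (gtr0_norm (_ : 0 < n^-1)) ?invr_gt0//.
have -> : \sum_x sin (Y x) = \sum_x (sin (Y x) - Y x) by rewrite sumrB EY subr0.
rewrite ler_pdivrMr//; apply: le_trans (ler_norm_sum _ _ _) _.
have H x : `|sin (Y x) - Y x| <= D ^+ 3 / 6.
  apply: le_trans (sin_sub_id_le _) _.
  by rewrite ler_pM2r ?invr_gt0// lerXn2r// nnegrE.
apply: le_trans (ler_sum _ (fun x _ => H x)) _.
by rewrite sumr_const -[leLHS]mulr_natr.
Qed.

Let e : R := expR (- (q / 2)).

Let e_le : e <= 1 - q / 2 + D ^+ 4 / 8.
Proof.
apply: le_trans (expRN_le_quadratic _) _; first by rewrite divr_ge0.
have : q ^+ 2 <= D ^+ 4 by rewrite (exprM _ 2 2) lerXn2r// nnegrE sqr_ge0.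
lra.
Qed.

Let e_ge : 1 - q / 2 <= e.
Proof. by have := expR_ge1Dx (- (q / 2)); rewrite -/e; lra. Qed.

(** Both [A] and [e] are at least [1 - q / 2], exceeding it by at most [D ^ 4 / 24] and [D ^ 4 / 8].
    As [e] is close to [1], the relative error [D ^ 4 / 3] has room to spare. *)
Let A_bounds : [/\ e * (1 - D ^+ 4 / 3) <= A, A <= e * (1 + D ^+ 4 / 3) & 99 / 100 <= A].
Proof.
have D4 : 0 <= D ^+ 4 by exact: exprn_ge0.
have H1 := A_ge; have H2 := A_le; have H3 := e_ge; have H4 := e_le.
have H5 := q_le; have H6 := D2; split; nra.
Qed.

Let SE : S = (n%:C * (A +i* B))%C.
Proof.
apply/eqP; rewrite eq_complex /S Re_sum Im_sum/= !mul0r subr0 addr0.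
have nn : n != 0 by rewrite gt_eqF.
by rewrite (mulrC n A) (mulrC n B) /A /B !divfK ?eqxx.
Qed.

Lemma local_upper t : normc S ^+ t <=
  n ^+ t * expR (- (t%:R * q / 2)) * (1 + D ^+ 6 / 4) `^ (t%:R / 2) * (1 + D ^+ 4 / 3) ^+ t.
Proof.
have [_ A1 A99] := A_bounds.
have D4 : 0 <= D ^+ 4 by exact: exprn_ge0.
have D6 : 0 <= D ^+ 6 by exact: exprn_ge0.
rewrite powR_half_natmul; last by lra.
rewrite (_ : - (t%:R * q / 2) = - (q / 2) * t%:R); last by lra.
rewrite expRM_natr -!exprMn lerXn2r ?nnegrE ?normc_ge0//.
  by rewrite !mulr_ge0 ?(ltW n0) ?expR_ge0 ?sqrtr_ge0//; lra.
rewrite SE normcM /normc/= expr0n/= addr0 sqrtr_sqr gtr0_norm//.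
rewrite -[leRHS]mulrA -[leRHS]mulrA ler_pM2l// -/e.
apply: (@le_trans _ _ (A * Num.sqrt (1 + D ^+ 6 / 4))); last first.
  by rewrite [leLHS]mulrC [leRHS]mulrCA ler_wpM2l ?sqrtr_ge0.
rewrite -{2}(@ger0_norm _ A); last by lra.
rewrite -sqrtr_sqr -sqrtrM ?sqr_ge0// ler_wsqrtr//.
have : B ^+ 2 <= (D ^+ 3 / 6) ^+ 2.
  by rewrite -(real_normK (num_real B)) lerXn2r ?nnegrE// divr_ge0// exprn_ge0.
rewrite (_ : (D ^+ 3 / 6) ^+ 2 = D ^+ 6 / 36); last by field.
move=> H; rewrite [leRHS]mulrDr mulr1 lerD2l.
apply: le_trans H _; have : (99 / 100) ^+ 2 <= A ^+ 2 by rewrite lerXn2r ?nnegrE//; lra.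
by nra.
Qed.

Lemma local_lower t : t%:R * D ^+ 3 < 2 ->
  n ^+ t * expR (- (t%:R * q / 2)) * (1 - D ^+ 4 / 3) ^+ t *
    (1 + t%:R ^+ 2 * D ^+ 6) `^ (- (1 / 2)) <= complex.Re (S ^+ t).
Proof.
move=> tD; have [A1 _ A99] := A_bounds.
have D4 : 0 <= D ^+ 4 by exact: exprn_ge0.
have D4' : D ^+ 4 <= 1 by rewrite exprn_ile1//; apply: le_trans D1 _; lra.
have A0 : 0 < A by lra.
pose b := B / A.
have SA : S ^+ t = ((n * A) ^+ t)%:C%C * (1 +i* b)%C ^+ t.
  rewrite rmorphXn -exprMn; congr (_ ^+ _); rewrite SE rmorphM -mulrA; congr (_ * _).
  have A1' : A != 0 by rewrite gt_eqF.
  by apply/eqP; rewrite eq_complex/= !mul0r subr0 addr0 mulr1 /b (mulrC A (B / A)) divfK// !eqxx.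
set T := t%:R ^+ 2 * D ^+ 6.
have T0 : 0 <= T by rewrite mulr_ge0 ?exprn_ge0.
have T4 : T <= 4.
  rewrite /T (exprM _ 3 2) -exprMn (_ : 4 = 2 ^+ 2) ?lerXn2r ?nnegrE ?mulr_ge0 ?exprn_ge0 ?(ltW tD)//.
  by rewrite expr2; lra.
(* [|B| <= D ^ 3 / 6] and [A >= 99 / 100] give [|b| <= D ^ 3 / 5], so that [t |b| < 2 / 5]. *)
have tb : t%:R * `|b| <= t%:R * D ^+ 3 / 5.
  rewrite -mulrA ler_wpM2l// /b normrM normfV (gtr0_norm A0) ler_pdivrMr//.
  apply: le_trans B_le _; have : 0 <= D ^+ 3 by exact: exprn_ge0.
  nra.
have H := @Re_oneDi_expn R b t (le_trans tb _).
have {}H : 1 - (t%:R * b) ^+ 2 <= complex.Re ((1 +i* b)%C ^+ t) by apply: H; lra.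
have tb2 : (t%:R * b) ^+ 2 <= T / 25.
  rewrite -(real_normK (num_real (_ * b))) normrM (ger0_norm (ler0n _ _)).
  apply: le_trans (_ : (t%:R * D ^+ 3 / 5) ^+ 2 <= _).
    by rewrite lerXn2r ?nnegrE ?mulr_ge0 ?exprn_ge0 ?invr_ge0.
  by rewrite /T (exprM _ 3 2) !exprMn; lra.
(* For [0 <= T <= 4] one has [(1 - T / 25) ^ 2 (1 + T) >= 1]. *)
have pT : (1 + T) `^ (- (1 / 2)) <= 1 - T / 25.
  rewrite powRN div1r powR12_sqrt; last by lra.
  have s0 : 0 < Num.sqrt (1 + T) by rewrite sqrtr_gt0; lra.
  rewrite -[_^-1]mul1r ler_pdivrMr//.
  have s0' := sqr_sqrtr (_ : 0 <= 1 + T).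
  have {s0'} ss : Num.sqrt (1 + T) ^+ 2 = 1 + T by rewrite sqr_sqrtr//; lra.
  rewrite -(@ler_pXn2r _ 2)// ?nnegrE ?mulr_ge0 ?(ltW s0)//; last by lra.
  rewrite exprMn ss expr1n; nra.
rewrite SA; case: ((1 +i* b)%C ^+ t) H => u v /= H; rewrite mul0r subr0.
rewrite (_ : - (t%:R * q / 2) = - (q / 2) * t%:R); last by lra.
have l0 : 0 <= n * e * (1 - D ^+ 4 / 3).
  by rewrite mulr_ge0 ?mulr_ge0 ?(ltW n0) ?expR_ge0//; lra.
have nA : 0 <= n * A by rewrite mulr_ge0// ltW.
rewrite expRM_natr -!exprMn ler_pM ?exprn_ge0 ?powR_ge0//.
- by rewrite lerXn2r ?nnegrE// -mulrA ler_pM2l.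
- by apply: le_trans pT _; apply: le_trans H; lra.
Qed.

End local.

(** * Exponential sums with two distant phases *)

Section far.
Variable R : realType.

Lemma expiD_2pi_int (a : R) (z : int) : expi (a + 2 * pi * z%:~R) = expi a.
Proof. by rewrite expiD expi_2pi_int mulr1. Qed.

Lemma cosD_2pi_int (a : R) (z : int) : cos (a + 2 * pi * z%:~R) = cos a.
Proof. exact: (congr1 (@complex.Re R) (expiD_2pi_int a z)). Qed.

Lemma cos_le_far (a eta : R) : 0 <= eta -> eta <= pi ->
  (forall z : int, eta <= `|a - 2 * pi * z%:~R|) -> cos a <= cos eta.
Proof.
move=> eta0 etapi far; have pi0 := pi_gt0 R.
(* This multiple of [2 pi] brings the angle into [[- pi, pi]], where the cosine decreases in the
   absolute value. *)
pose z := Num.floor ((a + pi) / (2 * pi)).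
pose b := a - 2 * pi * z%:~R.
have -> : cos a = cos `|b| by rewrite cos_norm -(cosD_2pi_int b z) /b subrK.
have bpi : `|b| <= pi.
  have p2 : 0 < 2 * pi :> R by rewrite mulr_gt0.
  have := floor_le_tmp ((a + pi) / (2 * pi)); have := floorD1_gt ((a + pi) / (2 * pi)).
  rewrite -/z intrD ltr_pdivrMr// ler_pdivlMr// => H1 H2.
  rewrite ler_norml /b; apply/andP; split; lra.
have := far z; rewrite -/b le_eqVlt => /predU1P[->//|lt].
by apply/ltW; rewrite ltr_cos ?in_itv/= ?eta0 ?etapi ?normr_ge0.
Qed.

(** Two unit vectors at angle at least [delta / 2] have a sum of length at most [2 cos (delta / 4)];
    the other terms count [1] each. The quartic bound and [delta <= 1] give a loss of
    [(1 / 16 - 1 / 3072) delta ^ 2], which is more than [11 / 192 delta ^ 2]. *)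
Lemma normc_sum_expi_far (X : finType) (Y : X -> R) (x y : X) (delta : R) :
  0 < delta -> delta <= 1 ->
  (forall z : int, delta / 2 <= `|Y x - Y y - 2 * pi * z%:~R|) ->
  normc (\sum_x expi (Y x)) <=
  #|X|%:R * expR (- (11 / 192) * #|X|%:R^-1 * delta ^+ 2).
Proof.
move=> d0 d1 far; have pi2 := pi_ge2 R.
have xy : y != x.
  apply/eqP => E; have := far 0; rewrite E subrr mulr0 subr0 normr0; lra.
have n0 : 0 < #|X|%:R :> R by rewrite ltr0n; apply/card_gt0P; exists x.
have ca : cos (Y x - Y y) <= cos (delta / 2) by apply: cos_le_far => //; lra.
have nxy : normc (expi (Y x) + expi (Y y)) <= 2 - 11 / 192 * delta ^+ 2.
  have c4 : 0 < cos (delta / 4).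
    have := cos_ge_quadratic (delta / 4); nra.
  apply: (@le_trans _ _ (2 * cos (delta / 4))).
    rewrite /normc/= -[leRHS]gtr0_norm; last by rewrite mulr_gt0.
    rewrite -sqrtr_sqr ler_wsqrtr//.
    have -> : (cos (Y x) + cos (Y y)) ^+ 2 + (sin (Y x) + sin (Y y)) ^+ 2 =
        2 + 2 * cos (Y x - Y y).
      by rewrite cosB; have := cos2Dsin2 (Y x); have := cos2Dsin2 (Y y); lra.
    move: ca; rewrite (_ : delta / 2 = (delta / 4) *+ 2); last by rewrite (mulr2n (delta / 4)); lra.
    rewrite cos_mulr2n (mulr2n (cos (delta / 4) ^+ 2)); lra.
  have := cos_le_quartic (delta / 4).
  have : delta ^+ 4 <= delta ^+ 2 by rewrite ler_wiXn2l// ltW.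
  have -> : (delta / 4) ^+ 2 = delta ^+ 2 / 16 by field.
  have -> : (delta / 4) ^+ 4 = delta ^+ 4 / 256 by field.
  have := sqr_ge0 delta; lra.
have nS : normc (\sum_x expi (Y x)) <= #|X|%:R - 11 / 192 * delta ^+ 2.
  rewrite (bigD1 x)//= (bigD1 y)//= addrA; apply: le_trans (le_normcD _ _) _.
  have : normc (\sum_(i | (i != x) && (i != y)) expi (Y i)) <= #|X|%:R - 2.
    apply: le_trans (normc_sum _ _ _) _; under eq_bigr do rewrite normc_expi.
    have -> : #|X|%:R = \sum_(i : X) 1 :> R by rewrite sumr_const.
    by rewrite [in leRHS](bigD1 x)//= [in leRHS](bigD1 y)//=; lra.
  lra.
apply: le_trans nS _; rewrite -ler_pdivrMl//; apply: le_trans (expR_ge1Dx _).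
by rewrite mulrBr mulVf ?gt_eqF//; lra.
Qed.

End far.

(** * The phase and its moments *)

Section phase.
Variables (R : realType) (k g1 : nat).
Local Notation g := g1.+2.
Local Notation G := (g%:R : R).
Local Notation point := {ffun 'I_k -> 'I_g}.
Implicit Types (theta : coord k g -> R) (x y : point) (p q : pairs k) (b : 'I_g).

Definition phase theta x : R := \sum_c theta c * Zvec R x c.

Definition pair_diff x p : 'I_g := x (val p).1 - x (val p).2.

(** Setting the value [0] at residue [0] turns the phase into a sum of centred functions on the
    whole group. *)
Definition pair_fun theta p b : R :=
  if insub b is Some a then theta (mkcoord p a) else 0.

Definition pair_mean theta p : R := (\sum_a theta (mkcoord p a)) / G.

Lemma zdiffE (u v : 'I_g) : zdiff u v = nat_of_ord (u - v).
Proof.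
rewrite /zdiff -addnBA; last exact: ltnW.
by rewrite -modnDmr.
Qed.

Lemma pair_fun0 theta p : pair_fun theta p 0 = 0.
Proof. by rewrite /pair_fun; case: insubP. Qed.

Lemma pair_fun_val theta p (a : nonzero_residue g) :
  pair_fun theta p (val a) = theta (mkcoord p a).
Proof. by rewrite /pair_fun valK. Qed.

Lemma sum_nonzero_residue (F : 'I_g -> R) : F 0 = 0 ->
  \sum_b F b = \sum_(a : nonzero_residue g) F (val a).
Proof.
move=> F0; rewrite (bigID (fun b : 'I_g => nat_of_ord b != 0%N))/= [X in _ + X]big1 ?addr0.
  rewrite (reindex_omap (val : nonzero_residue g -> 'I_g) insub)/=.
    by apply: eq_bigl => a; rewrite valK eqxx (valP a).
  by move=> b b0; case: insubP => [a _ /= ->//|]; rewrite b0.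
by move=> b /negPn/eqP b0; rewrite -F0; congr F; exact: val_inj.
Qed.

Lemma sum_pair_fun theta p (F : R -> R) : F 0 = 0 ->
  \sum_b F (pair_fun theta p b) = \sum_a F (theta (mkcoord p a)).
Proof.
move=> F0; rewrite sum_nonzero_residue ?pair_fun0//.
by apply: eq_bigr => a _; rewrite pair_fun_val.
Qed.

Lemma phaseE theta x :
  phase theta x = \sum_p (pair_fun theta p (pair_diff x p) - pair_mean theta p).
Proof.
rewrite /phase big_coord/=; apply: eq_bigr => p _; rewrite /pair_mean.
have zE (a : nonzero_residue g) :
    Zvec R x (mkcoord p a) = (pair_diff x p == val a)%:R - G^-1.
  rewrite /Zvec /=; case: p => -[i j] /= ij; rewrite zdiffE /pair_diff/= (val_eqE (x i - x j)).
  by case: eqP => _; rewrite ?sub0r.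
under eq_bigr do rewrite zE mulrBr; rewrite sumrB -mulr_suml; congr (_ - _).
rewrite /pair_fun; case: insubP => [a _ <-|].
  rewrite (bigD1 a)//= eqxx mulr1 big1 ?addr0// => b ba.
  by rewrite val_eqE eq_sym (negbTE ba) mulr0.
move=> b0; apply: big1 => a _; case: eqP => [E|_]; last by rewrite mulr0.
by rewrite E (valP a) in b0.
Qed.

Lemma pair_mean_avg theta p : \sum_b (pair_fun theta p b - pair_mean theta p) = 0.
Proof.
rewrite sumrB sumr_const card_ord -mulr_natr /pair_mean divfK ?pnatr_eq0//.
by rewrite (@sum_pair_fun theta p id)// subrr.
Qed.

Definition shift_coord (i : 'I_k) (s : 'I_g) x : point :=
  [ffun l => if l == i then x l + s else x l].

Lemma shift_coordK i s : cancel (shift_coord i s) (shift_coord i (- s)).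
Proof. by move=> x; apply/ffunP => l; rewrite !ffunE; case: eqP; rewrite ?addrK. Qed.

(** Translation invariance of the uniform measure: averaging over the shifts of one coordinate fixes
    [H] and replaces [F] by its vanishing mean. *)
Lemma sum_shift (i : 'I_k) (H : point -> R) (F : 'I_g -> point -> R) :
  (forall s x, H (shift_coord i s x) = H x) ->
  (forall x, \sum_s F s x = 0) ->
  (forall s x, F 0 (shift_coord i s x) = F s x) ->
  \sum_x F 0 x * H x = 0.
Proof.
move=> HH F0 FF; apply: (mulfI (_ : G != 0)); first by rewrite pnatr_eq0.
rewrite mulr0; set S := \sum_x _.
have -> : G * S = \sum_(s : 'I_g) S by rewrite sumr_const card_ord mulr_natl.
rewrite (eq_bigr (fun s : 'I_g => \sum_x F s x * H x)); last first.
  move=> s _; rewrite /S [LHS](reindex (shift_coord i s)).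
    by apply: eq_bigr => x _; rewrite FF HH.
  by exists (shift_coord i (- s)) => x _; rewrite ?shift_coordK// -{1}(opprK s) shift_coordK.
by rewrite exchange_big/=; apply: big1 => x _; rewrite -mulr_suml F0 mul0r.
Qed.

(** Shifting an endpoint of [p] moves [pair_diff x p] through the whole group without changing
    [H]. *)
Lemma sum_pair_diff_mul p (F : 'I_g -> R) (H : point -> R) (i : 'I_k) :
  \sum_b F b = 0 -> (i == (val p).1) || (i == (val p).2) ->
  (forall s x, H (shift_coord i s x) = H x) ->
  \sum_x F (pair_diff x p) * H x = 0.
Proof.
move=> F0 ip HH; have /= p12 := valP p; have n12 : (val p).1 != (val p).2.
  by apply: contraTneq p12 => ->; rewrite ltnn.
case/orP: ip => /eqP iE.
- transitivity (\sum_x F (pair_diff x p + 0) * H x); last first.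
  apply: (@sum_shift i H (fun s x => F (pair_diff x p + s)))=> //.
  + move=> x; rewrite -[RHS]F0 [RHS](reindex (fun s => pair_diff x p + s))//.
    exists (fun s => s - pair_diff x p) => s _; last by rewrite addrC subrK.
    by rewrite addrC addKr.
  + move=> s x; rewrite /pair_diff !ffunE iE eqxx eq_sym (negbTE n12) addr0.
    by rewrite addrAC.
  by apply: eq_bigr => x _; rewrite addr0.
- transitivity (\sum_x F (pair_diff x p - 0) * H x); last first.
  apply: (@sum_shift i H (fun s x => F (pair_diff x p - s)))=> //.
  + move=> x; rewrite -[RHS]F0 [RHS](reindex (fun s => pair_diff x p - s))//.
    by exists (fun s => pair_diff x p - s) => s _; rewrite opprB addrC subrK.
  + move=> s x; rewrite /pair_diff !ffunE iE eqxx (negbTE n12) subr0.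
    by rewrite opprD addrA.
  by apply: eq_bigr => x _; rewrite subr0.
Qed.

Lemma sum_pair_diff p (F : 'I_g -> R) :
  \sum_x F (pair_diff x p) = #|{: point}|%:R * ((\sum_b F b) / G).
Proof.
apply/eqP; rewrite -subr_eq0; apply/eqP; set m := _ / G.
have Fm : \sum_b (F b - m) = 0.
  by rewrite sumrB sumr_const card_ord -[m *+ g]mulr_natr divfK ?pnatr_eq0// subrr.
have i1 : ((val p).1 == (val p).1) || ((val p).1 == (val p).2) by rewrite eqxx.
have := @sum_pair_diff_mul p (fun b => F b - m) (fun=> 1) (val p).1 Fm i1 (fun _ _ => erefl).
under eq_bigr do rewrite mulr1.
by rewrite sumrB sumr_const -[m *+ _]mulr_natl.
Qed.

Lemma sum_phase theta : \sum_x phase theta x = 0.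
Proof.
under eq_bigr do rewrite phaseE; rewrite exchange_big/=; apply: big1 => p _.
by rewrite (sum_pair_diff p (fun b => pair_fun theta p b - pair_mean theta p))
  pair_mean_avg mul0r mulr0.
Qed.

(** The ordering of the endpoints matters: it excludes that [q] is [p] reversed. *)
Lemma pairs_neq_endpoint p q : p != q -> exists i,
  ((i == (val p).1) || (i == (val p).2)) && ((i != (val q).1) && (i != (val q).2)).
Proof.
case: p q => [[i j] /= ij] [[m n] /= mn]; rewrite -val_eqE/= xpair_eqE => pq.
have [im|im] := boolP ((i != m) && (i != n)); first by exists i; rewrite eqxx.
have [jm|jm] := boolP ((j != m) && (j != n)); first by exists j; rewrite eqxx orbT.
move: im jm pq; rewrite !negb_and !negbK => /orP[]/eqP iE /orP[]/eqP jE; subst i j.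
- by rewrite ltnn in ij.
- by rewrite !eqxx.
- by have := ltn_trans ij mn; rewrite ltnn.
- by rewrite ltnn in ij.
Qed.

(** The right side is [theta^T M theta]. The differences along a cycle are dependent, but two
    distinct pairs are always uncorrelated, so only the variance on each pair remains. *)
Lemma sum_phase_sqr theta : (\sum_x phase theta x ^+ 2) / #|{: point}|%:R =
  \sum_p ((\sum_a theta (mkcoord p a) ^+ 2) / G - pair_mean theta p ^+ 2).
Proof.
have n0 : #|{: point}|%:R != 0 :> R.
  by rewrite pnatr_eq0 card_ffun expn_eq0 card_ord.
apply: (mulIf n0); rewrite divfK// mulr_suml.
pose u p b := pair_fun theta p b - pair_mean theta p.
transitivity (\sum_x \sum_p \sum_q u p (pair_diff x p) * u q (pair_diff x q)).
  by apply: eq_bigr => x _; rewrite phaseE expr2 mulr_suml;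
    apply: eq_bigr => p _; rewrite mulr_sumr.
rewrite exchange_big/=; apply: eq_bigr => p _.
rewrite exchange_big/= (bigD1 p)//= [X in _ + X]big1 ?addr0; last first.
  move=> q qp; have [i /andP[ip /andP[iq1 iq2]]] : exists i,
      ((i == (val p).1) || (i == (val p).2)) && ((i != (val q).1) && (i != (val q).2)).
    by apply: pairs_neq_endpoint; rewrite eq_sym.
  apply: (@sum_pair_diff_mul p (u p) (fun x => u q (pair_diff x q)) i _ ip).
    exact: pair_mean_avg.
  by move=> s x; rewrite /pair_diff !ffunE ![_ == i]eq_sym (negbTE iq1) (negbTE iq2).
under eq_bigr do rewrite -expr2.
rewrite (sum_pair_diff p (fun b => u p b ^+ 2)) mulrC; congr (_ * _).
have -> : \sum_b u p b ^+ 2 = \sum_b pair_fun theta p b ^+ 2 - G * pair_mean theta p ^+ 2.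
  have -> : \sum_b u p b ^+ 2 = \sum_b (pair_fun theta p b ^+ 2
      - 2 * pair_mean theta p * u p b - pair_mean theta p ^+ 2).
    by apply: eq_bigr => b _; rewrite /u; ring.
  by rewrite !sumrB -mulr_sumr pair_mean_avg mulr0 subr0 sumr_const card_ord mulr_natl.
rewrite (@sum_pair_fun theta p (fun r : R => r ^+ 2)) ?expr0n//.
have G0 : G != 0 by rewrite pnatr_eq0.
by move: (G) G0 => z z0; field.
Qed.

Lemma phase_le theta (delta : R) x : (forall c, `|theta c| <= delta) ->
  `|phase theta x| <= (dimd k g)%:R * delta.
Proof.
move=> td; rewrite /phase; apply: le_trans (ler_norm_sum _ _ _) _.
have H c : `|theta c * Zvec R x c| <= delta.
  rewrite normrM -[leRHS]mulr1 ler_pM// /Zvec; case: (val c) => -[i j] a.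
  have g0 : 0 < G by rewrite ltr0n.
  have g1' : G^-1 <= 1 by rewrite invf_le1// ler1n.
  have gi0 : 0 < G^-1 by rewrite invr_gt0.
  move: (G^-1) g1' gi0 => z ? ?.
  by case: ifP => _; rewrite ler_norml; apply/andP; split; lra.
apply: le_trans (ler_sum _ (fun c _ => H c)) _.
by rewrite sumr_const card_coord mulr_natl.
Qed.

End phase.

(** * Peaks of the characteristic function *)

Lemma intr_Zp_eq0 g1 (m : int) : m%:~R = 0 :> 'I_g1.+2 -> exists z, m = g1.+2%:Z * z.
Proof.
have nat0 n : n%:R = 0 :> 'I_g1.+2 -> n = (g1.+2 * (n %/ g1.+2))%N.
  rewrite Zp_nat => /(congr1 val)/= n0.
  by rewrite {1}(divn_eq n g1.+2) n0 addn0 mulnC.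
case: m => n.
  by move=> /nat0 nE; exists (n %/ g1.+2)%N%:Z; rewrite {1}nE.
rewrite NegzE mulrNz => /eqP; rewrite oppr_eq0 => /eqP /nat0 nE.
by exists (- (n.+1 %/ g1.+2)%N%:Z); rewrite mulrN {1}nE.
Qed.

Lemma natr_Zp_self g1 : g1.+2%:R = 0 :> 'I_g1.+2.
Proof. by apply/val_inj; rewrite Zp_nat/= modnn. Qed.

Lemma Zp_additive_linear g1 (h : 'I_g1.+2 -> 'I_g1.+2) :
  (forall a b, h (a + b) = h a + h b) -> forall a, h a = h 1 * a.
Proof.
move=> hD a; have h0 : h 0 = 0 by apply: (addrI (h 0)); rewrite -hD !addr0.
rewrite -[in LHS](natr_Zp a) -[in RHS](natr_Zp a); elim: (nat_of_ord a) => [|n IH].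
  by rewrite h0 mulr0.
by rewrite -natr1 hD IH mulrDr mulr1.
Qed.

Lemma intr_norm_lt1 (R : realType) (z : int) : `|z%:~R : R| < 1 -> z = 0.
Proof.
by rewrite -intr_norm -[1]/(1%:~R) ltr_int; case: z => -[|n].
Qed.

Section peaks.
Variables (R : realType) (k g1 : nat).
Local Notation g := g1.+2.
Local Notation G := (g%:R : R).
Local Notation point := {ffun 'I_k -> 'I_g}.
Implicit Types (theta : coord k g -> R) (x y : point) (p q : pairs k) (a b : 'I_g).

(** Flow conservation at every vertex, in dual form: [c] is orthogonal to the differences of every
    potential [x]. *)
Definition circulation (c : {ffun pairs k -> 'I_g}) : bool :=
  [forall x : point, \sum_p c p * pair_diff x p == 0].

Section near_peak.
Variables (theta : coord k g -> R) (delta : R).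
Hypothesis delta0 : 0 < delta.
Hypothesis small : G * (('C(k, 2))%:R + 4) * delta <= 2.
Hypothesis near_const : forall x y,
  exists z : int, `|phase theta x - phase theta y - 2 * pi * z%:~R| < delta / 2.
Let G0 : 0 < G. Proof. by rewrite ltr0n. Qed.
Let gZ : (g%:Z)%:~R = G. Proof. by []. Qed.
Let gZ0 : (g%:Z)%:~R = 0 :> 'I_g. Proof. exact: natr_Zp_self. Qed.

Let two_point p a b : point :=
  [ffun l => if l == (val p).1 then a else if l == (val p).2 then b else 0].

(* The mixed second difference of the phase in the coordinates [i] and [j]
   isolates the single function attached to the pair [{i, j}]. *)
Let almost_additive p a b : exists z : int,
  `|pair_fun theta p (a + b) - pair_fun theta p a - pair_fun theta p b
    - 2 * pi * z%:~R| < delta.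
Proof.
have [z1 H1] := near_const (two_point p a (- b)) (two_point p a 0).
have [z2 H2] := near_const (two_point p 0 (- b)) (two_point p 0 0).
have E : phase theta (two_point p a (- b)) - phase theta (two_point p a 0)
    - (phase theta (two_point p 0 (- b)) - phase theta (two_point p 0 0)) =
    pair_fun theta p (a + b) - pair_fun theta p a - pair_fun theta p b.
  have /= p12 := valP p; have n12 : (val p).1 != (val p).2.
    by apply: contraTneq p12 => ->; rewrite ltnn.
  rewrite !phaseE -!sumrB (bigD1 p)//= big1 ?addr0.
    rewrite /pair_diff !ffunE !eqxx ![_.2 == _]eq_sym (negbTE n12).
    by rewrite ?opprK ?add0r ?subr0 ?oppr0 ?opprK ?pair_fun0; ring.
  move=> q qp; have [l] : exists i, ((i == (val p).1) || (i == (val p).2)) &&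
      ((i != (val q).1) && (i != (val q).2)).
    by apply: pairs_neq_endpoint; rewrite eq_sym.
  case/andP => /orP[]/eqP -> /andP[iq1 iq2]; rewrite /pair_diff !ffunE.
    by rewrite ![_ == (val p).1]eq_sym (negbTE iq1) (negbTE iq2); ring.
  by rewrite ![_ == (val p).2]eq_sym (negbTE iq1) (negbTE iq2); ring.
exists (z1 - z2); rewrite intrB -E; move: H1 H2; rewrite !ltr_norml; lra.
Qed.

Let Z p a b : int := sval (cid (almost_additive p a b)).
Let ZP p a b : `|pair_fun theta p (a + b) - pair_fun theta p a - pair_fun theta p b
  - 2 * pi * (Z p a b)%:~R| < delta := svalP (cid (almost_additive p a b)).
Let h p a : int := - \sum_b Z p a b.

(* Averaging over [b] cancels [pair_fun theta p (a + b) - pair_fun theta p b]. *)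
Let h_approx p a : `|pair_fun theta p a - 2 * pi * (h p a)%:~R / G| <= delta.
Proof.
have S : \sum_b (pair_fun theta p (a + b) - pair_fun theta p a - pair_fun theta p b
    - 2 * pi * (Z p a b)%:~R) =
    - G * (pair_fun theta p a - 2 * pi * (h p a)%:~R / G).
  rewrite !sumrB sumr_const card_ord -mulr_sumr.
  have -> : \sum_b pair_fun theta p (a + b) = \sum_b pair_fun theta p b.
    rewrite [RHS](reindex (fun b => a + b))//.
    exists (fun b => b - a) => b _; last by rewrite addrC subrK.
    by rewrite addrC addKr.
  rewrite /h mulrNz rmorph_sum/= -[_ *+ g]mulr_natl.
  set s := \sum_b (Z p a b)%:~R; set w := \sum_b _.
  by field_pi.
rewrite -(ler_pM2l G0) -[X in X * `|_|](gtr0_norm G0) -normrM -normrN -mulNr -S.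
apply: le_trans (ler_norm_sum _ _ _) _.
apply: le_trans (ler_sum _ (fun b _ => ltW (ZP p a b))) _.
by rewrite sumr_const card_ord mulr_natl.
Qed.

(** Rounding to the nearest multiple of [2 pi / g]. It serves with [4 delta] for additivity and with
    [(C(k, 2) + 1) delta] for the circulation identity, which explains the constant in [small]. *)
Let h_int_eq0 (m : int) (e : R) : `|2 * pi * m%:~R / G| < e -> G * e <= 2 * pi -> m = 0.
Proof.
have pi0 := pi_gt0 R; move=> me Ge; apply: (@intr_norm_lt1 R).
have p2 : 0 < 2 * pi / G by rewrite divr_gt0// mulr_gt0.
move: me; rewrite mulrAC normrM (gtr0_norm p2) => me.
rewrite -(ltr_pM2l p2) mulr1; apply: lt_le_trans me _.
by rewrite ler_pdivlMr// mulrC.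
Qed.

Let hD p a b : h p (a + b) = h p a + h p b + g%:Z * Z p a b.
Proof.
apply/eqP; rewrite -subr_eq0; apply/eqP; apply: (@h_int_eq0 _ (4 * delta)).
  have H1 := h_approx p a; have H2 := h_approx p b; have H3 := h_approx p (a + b).
  have H4 := ZP p a b.
  rewrite intrB !intrD intrM gZ.
  rewrite (_ : 2 * pi * _ / G = 2 * pi * (h p (a + b))%:~R / G - 2 * pi * (h p a)%:~R / G
    - 2 * pi * (h p b)%:~R / G - 2 * pi * (Z p a b)%:~R); last by field_pi.
  move: H1 H2 H3 H4; move: (2 * pi * (h p a)%:~R / G) (2 * pi * (h p b)%:~R / G) => u v.
  move: (2 * pi * (h p (a + b))%:~R / G) (2 * pi * (Z p a b)%:~R) => s z.
  by rewrite !ltr_norml !ler_norml; lra.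
have := pi_ge2 R; have := small; have := ler0n R 'C(k, 2).
have : 0 < G * delta by rewrite mulr_gt0.
nra.
Qed.

Let hbar p a : 'I_g := (h p a)%:~R.

Let hbarE p a : hbar p a = hbar p 1 * a.
Proof.
apply: Zp_additive_linear => {}a b; rewrite /hbar hD !intrD intrM.
by rewrite gZ0 mul0r addr0.
Qed.

(** Modulo [g], [h] is additive, hence multiplication by [c p]. The phases at [x] and at the zero
    point nearly agree modulo [2 pi], which by rounding forces an equality of integers: the
    circulation identity. *)
Lemma near_peak : exists2 c, circulation c & forall p (a : nonzero_residue g),
  exists z : int, `|theta (mkcoord p a)
    - 2 * pi * (nat_of_ord (c p))%:R * (nat_of_ord (val a))%:R / G
    - 2 * pi * z%:~R| <= delta.
Proof.
exists [ffun p => hbar p 1].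
  apply/forallP => x; apply/eqP; under eq_bigr do rewrite ffunE -hbarE.
  have [z Hz] := near_const x [ffun=> 0].
  have E : phase theta x - phase theta [ffun=> 0] = \sum_p pair_fun theta p (pair_diff x p).
    rewrite !phaseE -sumrB; apply: eq_bigr => p _.
    by rewrite [pair_diff [ffun=> 0] p]/pair_diff !ffunE subrr pair_fun0; ring.
  have D : `|\sum_p (pair_fun theta p (pair_diff x p)
      - 2 * pi * (h p (pair_diff x p))%:~R / G)| <= ('C(k, 2))%:R * delta.
    apply: le_trans (ler_norm_sum _ _ _) _.
    apply: le_trans (ler_sum _ (fun p _ => h_approx p _)) _.
    by rewrite sumr_const card_pairs mulr_natl.
  have S0 : \sum_p h p (pair_diff x p) - g%:Z * z = 0.
    apply: (@h_int_eq0 _ (('C(k, 2))%:R * delta + delta)).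
      move: D Hz; rewrite sumrB -E.
      have -> : \sum_p 2 * pi * (h p (pair_diff x p))%:~R / G =
          2 * pi * (\sum_p h p (pair_diff x p))%:~R / G.
        by rewrite rmorph_sum/= mulr_sumr mulr_suml.
      rewrite intrB intrM gZ ler_norml ltr_norml.
      rewrite (_ : 2 * pi * (_ - _) / G = 2 * pi * (\sum_p h p (pair_diff x p))%:~R / G
        - 2 * pi * z%:~R); last by field_pi.
      move: (2 * pi * (\sum_p h p (pair_diff x p))%:~R / G) (2 * pi * z%:~R) => u v.
      by rewrite ltr_norml; lra.
    have := pi_ge2 R; have := small; have := ler0n R 'C(k, 2).
    have : 0 < G * delta by rewrite mulr_gt0.
    nra.
  have /(congr1 (fun m : int => m%:~R : 'I_g)) := S0.
  by rewrite intrB intrM gZ0 mul0r subr0 rmorph_sum.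
move=> p a; rewrite ffunE; set cp := hbar p 1.
have [z zE] : exists z : int, h p (val a) =
    (nat_of_ord cp * nat_of_ord (val a))%N%:Z + g%:Z * z.
  have [z zE] : exists z, h p (val a) - (nat_of_ord cp * nat_of_ord (val a))%N%:Z = g%:Z * z.
    apply: intr_Zp_eq0; rewrite intrB -/(hbar p (val a)) hbarE -/cp [X in _ - X]natrM.
    by rewrite !natr_Zp subrr.
  by exists z; rewrite -zE addrC subrK.
exists z; have := h_approx p (val a); rewrite pair_fun_val zE intrD intrM gZ.
rewrite [(_ * _)%N%:~R]natrM.
rewrite (_ : 2 * pi * (_ + _) / G = 2 * pi * (nat_of_ord cp)%:R * (nat_of_ord (val a))%:R / G
  + 2 * pi * z%:~R); last by field_pi.
by rewrite opprD addrA.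
Qed.

End near_peak.

End peaks.

(** * Fourier inversion on the finite grid *)

Section fourier.
Variables (R : realType) (k g1 : nat).
Local Notation g := g1.+2.
Local Notation G := (g%:R : R).
Local Notation point := {ffun 'I_k -> 'I_g}.
Implicit Types (theta eta : coord k g -> R) (x y : point) (p q : pairs k) (a b : 'I_g).
Let G0 : 0 < G. Proof. by rewrite ltr0n. Qed.

Definition charsum theta : R[i] := \sum_x expi (phase theta x).

Definition dft_angle N (j : {ffun coord k g -> 'I_N}) (c : coord k g) : R :=
  2 * pi / N%:R * (j c)%:R.

Lemma charsumX theta t :
  charsum theta ^+ t = \sum_(w : {ffun 'I_t -> point}) expi (\sum_s phase theta (w s)).
Proof.
rewrite -[in LHS](card_ord t) -prodr_const bigA_distr_bigA/=.
by apply: eq_bigr => w _; rewrite expi_sum.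
Qed.

Lemma card_point : #|{: point}|%:R = G ^+ k.
Proof. by rewrite card_ffun !card_ord natrX. Qed.

(** As [g] divides [t], each coordinate of the walk is the integer [hits - t / g]. Both numbers are
    below [N], so the roots of unity detect their equality exactly. *)
Lemma prob_return_dft N t : (g %| t)%N -> (t < N)%N ->
  prob_return R k g t * (G ^+ k) ^+ t * N%:R ^+ dimd k g =
  \sum_(j : {ffun coord k g -> 'I_N}) complex.Re (charsum (dft_angle j) ^+ t).
Proof.
move=> gt tN; have N0 : (0 < N)%N by apply: leq_ltn_trans tN.
pose hits (w : {ffun 'I_t -> point}) (c : coord k g) : nat :=
  (\sum_(s < t) (zdiff (w s (val c).1.1) (w s (val c).1.2) == nat_of_ord (val c).2))%N.
have tg : t%:R / G = (t %/ g)%:R :> R.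
  by rewrite -{1}(divnK gt) natrM mulfK// gt_eqF.
have ZE (w : {ffun 'I_t -> point}) (c : coord k g) : \sum_(s < t) Zvec R (w s) c = (hits w c)%:R - (t %/ g)%:R.
  rewrite -tg natr_sum mulrC -[X in _ - X](_ : \sum_(s < t) G^-1 = _); last first.
    by rewrite sumr_const card_ord -[LHS]mulr_natr.
  rewrite -sumrB; apply: eq_bigr => s _; rewrite /Zvec; case: (val c) => -[i j] a/=.
  by case: eqP => _; rewrite ?sub0r.
have hitsN (w : {ffun 'I_t -> point}) (c : coord k g) : (hits w c < N)%N.
  apply: leq_ltn_trans tN; rewrite -[leqRHS]card_ord -sum1_card.
  by apply: leq_sum => s _; case: eqP.
have qN : (t %/ g < N)%N by apply: leq_ltn_trans tN; exact: leq_div.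
rewrite -Re_sum.
have -> : \sum_(j : {ffun coord k g -> 'I_N}) charsum (dft_angle j) ^+ t =
  \sum_(w : {ffun 'I_t -> point}) \prod_c \sum_(i < N) expi (2 * pi / N%:R * i%:R * ((hits w c)%:R - (t %/ g)%:R)).
  under eq_bigr do rewrite charsumX.
  rewrite exchange_big/=; apply: eq_bigr => w _; rewrite bigA_distr_bigA/=.
  apply: eq_bigr => j _; rewrite -expi_sum; congr expi.
  rewrite exchange_big/=; apply: eq_bigr => c _.
  by rewrite -mulr_sumr ZE.
under eq_bigr => w _ do under eq_bigr => c _ do rewrite sum_expi_roots//.
rewrite (eq_bigr (fun w : {ffun 'I_t -> point} => ((if [forall c, \sum_(s < t) Zvec R (w s) c == 0]
    then N%:R ^+ dimd k g else 0)%:C)%C)); last first.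
  move=> w _; rewrite -rmorph_prod/=; congr (_%:C)%C.
  case: ifPn => [/forallP H|].
    rewrite -card_coord -prodr_const; apply: eq_bigr => c _.
    by have := H c; rewrite ZE subr_eq0 eqr_nat => ->.
  rewrite negb_forall => /existsP[c]; rewrite ZE subr_eq0 eqr_nat => /negbTE E.
  by rewrite (bigD1 c)//= E mul0r.
rewrite -rmorph_sum -[RHS]/(\sum_(w : {ffun 'I_t -> point})
  (if [forall c, \sum_(s < t) Zvec R (w s) c == 0] then N%:R ^+ dimd k g else 0)).
rewrite -big_mkcond sumr_const -[RHS]mulr_natl /prob_return cardsE; congr (_ * _).
have -> : (G ^+ k) ^+ t = #|{: {ffun 'I_t -> point}}|%:R.
  by rewrite -card_point -natrX [in RHS]card_ffun card_ord.
by rewrite divfK// pnatr_eq0 !card_ffun !card_ord !expn_eq0.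
Qed.

End fourier.

(** * Invariance under translation by a peak *)

Lemma expi_sub_2pi_int (R : realType) (a b : R) (z : int) :
  a = b + 2 * pi * z%:~R -> expi a = expi b.
Proof. by move=> ->; rewrite expiD_2pi_int. Qed.

Lemma sum_ord_natr (R : realType) n : \sum_(i < n) i%:R * 2 = n%:R * (n%:R - 1) :> R.
Proof.
elim: n => [|n IH]; first by rewrite big_ord0 mul0r.
by rewrite big_ord_recr/= IH -natr1; ring.
Qed.

Section peak_invariance.
Variables (R : realType) (k g1 : nat).
Local Notation g := g1.+2.
Local Notation G := (g%:R : R).
Local Notation point := {ffun 'I_k -> 'I_g}.
Implicit Types (theta eta : coord k g -> R) (x y : point) (p q : pairs k) (a b : 'I_g).
Let G0 : 0 < G. Proof. by rewrite ltr0n. Qed.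
Let gZ : (g%:Z)%:~R = G. Proof. by []. Qed.

Variables (t : nat) (c : {ffun pairs k -> 'I_g}).
Hypotheses (gt : (g %| t)%N) (even_t : ~~ odd ((t %/ g) * g.-1)).
Hypothesis circ : circulation c.

(** The integers [z] allow for the reduction of grid angles to [[0, 2 pi)], a range which the box
    around a peak may leave. *)
Definition peak (z : coord k g -> int) (cc : coord k g) : R :=
  2 * pi * (nat_of_ord (c (coord_pair cc)))%:R * (nat_of_ord (val (coord_residue cc)))%:R / G
  + 2 * pi * (z cc)%:~R.

(** The circulation identity makes the part depending on [x] a multiple of [2 pi]. *)
Let peak_phase z x : exists n : int,
  phase (peak z) x = 2 * pi * n%:~R - \sum_p pair_mean (peak z) p.
Proof.
pose z' p b : int := if insub b is Some a then z (mkcoord p a) else 0.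
have fE p b : pair_fun (peak z) p b =
    2 * pi * ((nat_of_ord (c p) * nat_of_ord b)%N%:R / G) + 2 * pi * (z' p b)%:~R.
  rewrite /pair_fun /z' /peak; case: insubP => [a _ <-|/negPn/eqP->].
    by rewrite coord_pairK coord_residueK natrM; field_pi.
  by rewrite muln0 !mul0r !mulr0 addr0.
have /forallP/(_ x)/eqP S0 := circ.
have [n nE] : exists n : int, (\sum_p nat_of_ord (c p) * nat_of_ord (pair_diff x p))%N%:Z = g%:Z * n.
  apply: intr_Zp_eq0; rewrite -[RHS]S0 -[LHS]/(_%:R) natr_sum.
  by apply: eq_bigr => p _; rewrite natrM !natr_Zp.
exists (n + \sum_p z' p (pair_diff x p)).
rewrite phaseE sumrB; congr (_ - _); under eq_bigr do rewrite fE.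
rewrite big_split/= -!mulr_sumr -mulrDr intrD rmorph_sum/=; congr (_ * (_ + _)).
rewrite -mulr_suml -natr_sum.
have -> : (\sum_p nat_of_ord (c p) * nat_of_ord (pair_diff x p))%N%:R = G * n%:~R :> R.
  by rewrite -gZ -intrM -nE.
by field; rewrite gt_eqF.
Qed.

(** The residues sum to [g (g - 1) / 2], so [t] times the mean on [p] is [pi (t / g) (g - 1) c_p]
    modulo [2 pi]; [even_t] disposes of the half. *)
Let peak_mean z : exists n : int, t%:R * \sum_p pair_mean (peak z) p = 2 * pi * n%:~R.
Proof.
have tE : t%:R = (t %/ g)%:R * G :> R by rewrite -natrM divnK.
pose e := ((t %/ g) * g.-1)./2.
have eE : (t %/ g)%:R * (G - 1) = 2 * e%:R :> R.
  rewrite -[G]/(g.-1.+1%:R) -natr1 addrK -natrM -(odd_double_half (t %/ g * g.-1)).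
  by rewrite (negbTE even_t) add0n -muln2 natrM mulrC.
exists ((e * \sum_p nat_of_ord (c p))%N%:Z
  + (t %/ g)%N%:Z * \sum_p \sum_a z (mkcoord p a)).
have mE p : pair_mean (peak z) p =
    pi * (nat_of_ord (c p))%:R * (G - 1) / G + 2 * pi * (\sum_a z (mkcoord p a))%:~R / G.
  rewrite /pair_mean /peak.
  under eq_bigr do rewrite coord_pairK coord_residueK.
  rewrite big_split/= mulrDl -mulr_sumr -rmorph_sum/=; congr (_ / _ + _).
  rewrite -mulr_suml -mulr_sumr.
  have -> : \sum_(a : nonzero_residue g) (nat_of_ord (val a))%:R = G * (G - 1) / 2 :> R.
    rewrite -(@sum_nonzero_residue R g1 (fun b => (nat_of_ord b)%:R))//.
    by rewrite -sum_ord_natr -mulr_suml mulfK.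
  by field_pi.
rewrite (eq_bigr _ (fun p _ => mE p)).
rewrite big_split/= -!mulr_suml -!mulr_sumr.
have tZ : ((t %/ g)%N%:Z)%:~R = (t %/ g)%:R :> R by [].
rewrite intrD intrM [(_ * _)%N%:~R]natrM natr_sum tZ tE.
have -> : e%:R = (t %/ g)%:R * (G - 1) / 2 :> R by rewrite eE; field.
rewrite rmorph_sum/=; move: (\sum_p _%:~R) => Z; move: (\sum_i _) => C.
by field_pi.
Qed.

Lemma charsum_peak theta z :
  charsum (fun cc => theta cc + peak z cc) ^+ t = charsum theta ^+ t.
Proof.
pose w : R[i] := expi (- \sum_p pair_mean (peak z) p).
have -> : charsum (fun cc => theta cc + peak z cc) = charsum theta * w.
  rewrite /charsum mulr_suml; apply: eq_bigr => x _; rewrite -expiD.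
  have [n nE] := peak_phase z x; apply: (@expi_sub_2pi_int _ _ _ n).
  have -> : phase (fun cc => theta cc + peak z cc) x = phase theta x + phase (peak z) x.
    by rewrite /phase -big_split/=; apply: eq_bigr => cc _; rewrite mulrDl.
  by rewrite nE; lra.
rewrite exprMn -expiMn -[RHS]mulr1; congr (_ * _).
have [n nE] := peak_mean z; rewrite -expi0; apply: (@expi_sub_2pi_int _ _ _ (- n)).
by rewrite -[LHS]mulr_natl mulrN nE mulrNz add0r mulrN.
Qed.

End peak_invariance.

(** * Splitting the frequency grid into boxes around peaks and far points *)

Lemma absz_shift (s : int) (m : nat) : (absz s <= m)%N ->
  (absz (s + m%:Z)%R < (2 * m).+1)%N /\ 0 <= s + m%:Z.
Proof. by move=> ?; split; lia. Qed.

Lemma modn_eq_of_int (w j N : nat) (z : int) : (j < N)%N ->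
  w%:Z = j%:Z + N%:Z * z -> (w %% N)%N = j.
Proof.
move=> jN; case: z => y E; last by exfalso; nia.
have -> : w = (y * N + j)%N by lia.
by rewrite modnMDl modn_small.
Qed.

Section grid.
Variables (R : realType) (k g1 N n1 m t : nat) (delta : R).
Local Notation g := g1.+2.
Local Notation G := (g%:R : R).
Local Notation point := {ffun 'I_k -> 'I_g}.
Local Notation peaks := {ffun pairs k -> 'I_g}.
Local Notation box := {ffun coord k g -> 'I_(2 * m).+1}.
Local Notation freqs := {ffun coord k g -> 'I_N}.
Hypotheses (NE : N = (g * n1)%N) (mn1 : (2 * m < n1)%N) (tN : (t < N)%N).
Hypotheses (delta0 : 0 < delta) (delta1 : delta <= 1).
Hypothesis small : G * (('C(k, 2))%:R + 4) * delta <= 2.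
Hypothesis deltam : delta < (m%:R + 1) * (2 * pi / N%:R).
Hypotheses (gt : (g %| t)%N) (even_t : ~~ odd ((t %/ g) * g.-1)).

Let G0 : 0 < G. Proof. by rewrite ltr0n. Qed.
Let N0 : (0 < N)%N. Proof. by apply: leq_ltn_trans tN. Qed.
Let NR0 : 0 < N%:R :> R. Proof. by rewrite ltr0n. Qed.
Let n1R0 : 0 < n1%:R :> R. Proof. by rewrite ltr0n (leq_ltn_trans _ mn1). Qed.
Let NRE : N%:R = G * n1%:R :> R. Proof. by rewrite NE natrM. Qed.
Let mN : (2 * m < N)%N. Proof. by rewrite NE (leq_trans mn1)// leq_pmull. Qed.

Let mleN : (m <= N)%N. Proof. by apply: leq_trans (ltnW mN); rewrite leq_pmull. Qed.

Definition box_angle (b : box) (c : coord k g) : R := grid_point R N (b c).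

(* [b cc] encodes the signed offset [b cc - m]; [N - m] replaces [- m] modulo [N]. *)
Definition peak_index (c : peaks) (b : box) (cc : coord k g) : nat :=
  (b cc + (N - m) + n1 * (c (coord_pair cc) * val (coord_residue cc)))%N.

Definition near_freq (u : peaks * box) : freqs :=
  [ffun cc => Ordinal (ltn_pmod (peak_index u.1 u.2 cc) N0)].

Let near_freq_angle (c : peaks) (b : box) : exists z,
  dft_angle R (near_freq (c, b)) = (fun cc => box_angle b cc + peak R c z cc).
Proof.
exists (fun cc => 1 - (peak_index c b cc %/ N)%N%:Z); apply/funext => cc.
rewrite /dft_angle /box_angle /grid_point /peak ffunE/=.
have := divn_eq (peak_index c b cc) N.
set e := peak_index c b cc; set r := (e %% N)%N; set s := (e %/ N)%N => eE.
have rE : r%:R = (b cc)%:R - m%:R + N%:R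
    + n1%:R * ((c (coord_pair cc))%:R * (val (coord_residue cc))%:R) - s%:R * N%:R :> R.
  have : e%:R = s%:R * N%:R + r%:R :> R by rewrite eE natrD natrM.
  rewrite {1}/e /peak_index !natrD !natrM natrB//.
  by lra.
have sZ : (s%:Z)%:~R = s%:R :> R by [].
by rewrite rE intrB sZ NRE; field_pi.
Qed.

Let charsum_near_freq c b : circulation c ->
  charsum (dft_angle R (near_freq (c, b))) ^+ t = charsum (box_angle b) ^+ t.
Proof. by move=> circ; have [z ->] := near_freq_angle c b; exact: charsum_peak. Qed.

(** After cancelling [N - m] both sides are below [N], and [x], [u] are the remainder and quotient
    by [n1] since [2 m < n1]. *)
Let congr_small (x y u v : nat) : (x <= 2 * m)%N -> (y <= 2 * m)%N ->
  (u < g)%N -> (v < g)%N -> (x + (N - m) + n1 * u = y + (N - m) + n1 * v %[mod N])%N ->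
  x = y /\ u = v.
Proof.
move=> xm ym ug vg.
rewrite -!addnA ![((N - m) + _)%N]addnC !addnA => /eqP; rewrite eqn_modDr.
have lt (w z : nat) : (w <= 2 * m)%N -> (z < g)%N -> (w + n1 * z < N)%N.
  move=> wm zg; apply: (@leq_trans (n1 + n1 * z)).
    by rewrite ltn_add2r (leq_ltn_trans wm).
  by rewrite NE -mulnS mulnC leq_mul2r zg orbT.
rewrite !modn_small ?lt// => /eqP E.
have div (w z : nat) : (w <= 2 * m)%N -> ((w + n1 * z) %/ n1)%N = z.
  move=> wm; have wn : (w < n1)%N by apply: leq_ltn_trans mn1.
  by rewrite mulnC divnDMl ?(leq_ltn_trans _ wn)// divn_small.
have uv : u = v by rewrite -(div x u xm) E div.
by split=> //; move: E; rewrite uv => /addIn.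
Qed.

Let one : nonzero_residue g := exist _ (Ordinal (isT : (1 < g)%N)) isT.

Let ord_le (i : 'I_(2 * m).+1) : (i <= 2 * m)%N. Proof. by rewrite -ltnS. Qed.

Let near_freq_inj : injective near_freq.
Proof.
move=> [c b] [c' b'] /ffunP E.
have H cc : (peak_index c b cc = peak_index c' b' cc %[mod N])%N.
  by have := E cc; rewrite !ffunE/= => /(congr1 val).
have cE : c = c'.
  (* At residue [1] the index contains [n1] times [c p] itself, which is below [g]. *)
  apply/ffunP => p; apply: val_inj; have := H (mkcoord p one).
  rewrite /peak_index coord_pairK coord_residueK !muln1.
  by case/congr_small.
subst c'; congr (_, _); apply/ffunP => cc; apply: val_inj; have /eqP := H cc.
rewrite /peak_index -!addnA eqn_modDr !modn_small; first by move=> /eqP.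
  exact: leq_ltn_trans (ord_le _) mN.
exact: leq_ltn_trans (ord_le _) mN.
Qed.

(** Contrapositive of [near_peak]: off the boxes some two phases are at distance at least
    [delta / 2] modulo [2 pi]. *)
Let far_freq (j : freqs) : (forall u, circulation u.1 -> j <> near_freq u) ->
  normc (charsum (dft_angle R j)) <=
  G ^+ k * expR (- (11 / 192) * (G ^+ k)^-1 * delta ^+ 2).
Proof.
move=> notnear; rewrite -card_point.
have [near|] := pselect (forall x y, exists z : int,
    `|phase (dft_angle R j) x - phase (dft_angle R j) y - 2 * pi * z%:~R| < delta / 2); last first.
  move=> /existsNP[x /existsNP[y /forallNP farz]].
  by apply: (@normc_sum_expi_far R _ _ x y) => // z; rewrite leNgt; apply/negP.
exfalso; have [c circ cP] := near_peak delta0 small near.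
have pi0 := pi_gt0 R.
have step cc : exists s : 'I_(2 * m).+1, nat_of_ord (j cc) = (peak_index c [ffun=> s] cc %% N)%N.
  have [z] := cP (coord_pair cc) (coord_residue cc); rewrite mkcoordK /dft_angle.
  pose ca := (nat_of_ord (c (coord_pair cc)) * nat_of_ord (val (coord_residue cc)))%N.
  move=> zP.
  (* The signed offset from the peak in grid steps. The mesh times [|s|] is at most [delta], so
     [|s| < m + 1], and integrality gives [|s| <= m]. *)
  pose s : int := (j cc)%:Z - n1%:Z * ca%:Z - N%:Z * z.
  have sm : `|s%:~R : R| < m%:R + 1.
    have p0 : 0 < 2 * pi / N%:R :> R by rewrite divr_gt0// mulr_gt0.
    rewrite -(ltr_pM2r p0); apply: le_lt_trans deltam.
    rewrite -[X in _ * X](gtr0_norm p0) -normrM; apply: le_trans zP.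
    rewrite le_eqVlt; apply/orP; left; apply/eqP; congr `|_|.
    rewrite /s !intrB !intrM.
    rewrite -[(j cc)%:~R]/((j cc)%:R : R) -[n1%:~R]/(n1%:R : R) -[N%:~R]/(N%:R : R).
    rewrite -[ca%:~R]/(ca%:R : R) natrM NRE.
    by field_pi.
  have {}sm : (`|s| <= m)%N.
    move: sm; rewrite -intr_norm natr1 -[m.+1%:R]/((m.+1%:Z)%:~R : R) ltr_int.
    by rewrite -abszE ltz_nat ltnS.
  have [s0 /gez0_abs sabs] := absz_shift sm.
  exists (Ordinal s0); rewrite /peak_index ffunE/= -/ca; apply/esym.
  apply: (@modn_eq_of_int _ _ _ (1 - z) (ltn_ord (j cc))).
  rewrite !PoszD PoszM sabs -subzn// /s; ring.
have [s sP] := choice step.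
apply: (notnear (c, [ffun cc => s cc]) circ); apply/ffunP => cc; apply: val_inj.
apply: etrans (sP cc) _; rewrite /near_freq [in RHS]ffunE/=.
by rewrite /peak_index /= !ffunE.
Qed.

(** The boxes are disjoint and contribute equally by [charsum_peak]; at most [N ^ d] points
    remain. *)
Lemma prob_return_grid :
  `|prob_return R k g t * (G ^+ k) ^+ t * N%:R ^+ dimd k g
    - #|[pred c : peaks | circulation c]|%:R *
      \sum_(b : box) complex.Re (charsum (box_angle b) ^+ t)|
  <= N%:R ^+ dimd k g * ((G ^+ k) ^+ t * err_term k g t delta).
Proof.
rewrite (prob_return_dft R k gt tN).
pose near := finset (fun u : peaks * box => circulation u.1).
rewrite (bigID (mem (near_freq @: near)))/=.
have -> : \sum_(j in near_freq @: near) complex.Re (charsum (dft_angle R j) ^+ t) =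
    #|[pred c : peaks | circulation c]|%:R *
      \sum_(b : box) complex.Re (charsum (box_angle b) ^+ t).
  rewrite big_imset/=; last by move=> u v _ _; exact: near_freq_inj.
  rewrite -sum1_card natr_sum mulr_suml.
  rewrite [RHS](eq_bigr (fun=> \sum_(b : box) complex.Re (charsum (box_angle b) ^+ t))); last first.
    by move=> c _; rewrite mul1r.
  rewrite pair_big_dep/=; apply: eq_big => [[c b]|[c b]]; first by rewrite !inE andbT.
  by rewrite inE => circ; rewrite charsum_near_freq.
rewrite addrAC subrr add0r.
apply: le_trans (ler_norm_sum _ _ _) _.
have B (j : freqs) : j \notin near_freq @: near ->
    `|complex.Re (charsum (dft_angle R j) ^+ t)| <= (G ^+ k) ^+ t * err_term k g t delta.
  move=> jn; apply: le_trans (Re_le_normc _) _; rewrite normcX.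
  have -> : (G ^+ k) ^+ t * err_term k g t delta =
      (G ^+ k * expR (- (11 / 192) * (G ^+ k)^-1 * delta ^+ 2)) ^+ t.
    by rewrite exprMn -expRM_natr /err_term; congr (_ * expR _); ring.
  apply: lerXn2r; rewrite ?nnegrE ?normc_ge0 ?mulr_ge0 ?exprn_ge0 ?expR_ge0 ?ler0n//.
  apply: far_freq => u circ jE; move/negP: jn; apply; apply/imsetP; exists u => //.
  by rewrite inE.
apply: le_trans (ler_sum _ B) _.
rewrite sumr_const -[leLHS]mulr_natl ler_wpM2r//.
  by rewrite mulr_ge0 ?exprn_ge0 ?expR_ge0 ?ler0n.
rewrite -natrX ler_nat -card_coord -[X in (X ^ _)%N](card_ord N) -card_ffun.
exact: max_card.
Qed.

End grid.

(** * Counting circulations on the complete graph *)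

Section card_circulation.
Variables (k g1 : nat).
Local Notation g := g1.+2.
Local Notation point := {ffun 'I_k.+1 -> 'I_g}.

(** The edges at vertex [0] form a spanning tree, so the values on the other edges are free and
    determine the circulation. *)
Definition cone_pair (j : 'I_k) : pairs k.+1 := exist _ (ord0, lift ord0 j) isT.

Definition lift_pair (p : pairs k) : pairs k.+1 :=
  exist _ (lift ord0 (val p).1, lift ord0 (val p).2) (valP p).

Definition unlift_pair (q : pairs k.+1) : option (pairs k) :=
  match unlift ord0 (val q).1, unlift ord0 (val q).2 with
  | Some i, Some j => insub (i, j)
  | _, _ => None
  end.

Lemma lift_pairK : pcancel lift_pair unlift_pair.
Proof. by move=> p; rewrite /unlift_pair/= !liftK -surjective_pairing valK. Qed.

Lemma cone_or_lift (q : pairs k.+1) :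
  (exists j, q = cone_pair j) \/ (exists p, q = lift_pair p).
Proof.
case: q => -[i j] /= ij; have [j' jE|jE] := unliftP ord0 j; last first.
  by exfalso; move: ij; rewrite jE.
have [i' iE|iE] := unliftP ord0 i; last first.
  by left; exists j'; apply: val_inj; rewrite /= jE iE.
right; have ij' : (i' < j')%N by move: ij; rewrite iE jE.
by exists (exist _ (i', j') ij'); apply: val_inj; rewrite /= jE iE.
Qed.

Lemma sum_pairs_split (V : nmodType) (F : pairs k.+1 -> V) :
  \sum_q F q = \sum_j F (cone_pair j) + \sum_p F (lift_pair p).
Proof.
rewrite (bigID (fun q => unlift_pair q == None))/=; congr (_ + _).
  rewrite (reindex_omap cone_pair (fun q => unlift ord0 (val q).2))/=.
    by apply: eq_bigl => j; rewrite liftK eqxx andbT /unlift_pair/= unlift_none.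
  move=> q; case: (cone_or_lift q) => [[j ->]|[p ->]]; first by rewrite /= liftK.
  by rewrite lift_pairK.
rewrite (reindex_omap lift_pair unlift_pair)/=.
  by apply: eq_bigl => p; rewrite lift_pairK/= eqxx.
move=> q; case: (cone_or_lift q) => [[j ->]|[p ->]]; last by rewrite lift_pairK.
by rewrite /unlift_pair/= unlift_none.
Qed.

Definition net_flow (d : {ffun pairs k -> 'I_g}) (j : 'I_k) : 'I_g :=
  \sum_(p | (val p).1 == j) d p - \sum_(p | (val p).2 == j) d p.

Definition restrict_flow (c : {ffun pairs k.+1 -> 'I_g}) : {ffun pairs k -> 'I_g} :=
  [ffun p => c (lift_pair p)].

Definition extend_flow (d : {ffun pairs k -> 'I_g}) : {ffun pairs k.+1 -> 'I_g} :=
  [ffun q => if unlift_pair q is Some p then d p else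
     if unlift ord0 (val q).2 is Some j then net_flow d j else 0].

Lemma extend_flow_cone d j : extend_flow d (cone_pair j) = net_flow d j.
Proof. by rewrite ffunE /unlift_pair/= unlift_none liftK. Qed.

Lemma extend_flow_lift d p : extend_flow d (lift_pair p) = d p.
Proof. by rewrite ffunE lift_pairK. Qed.

(** Summation by parts, with potentials measured from vertex [0]. As these are arbitrary, a
    circulation takes the value [net_flow] on each cone edge. *)
Lemma sum_flow (c : {ffun pairs k.+1 -> 'I_g}) (x : point) :
  \sum_q c q * pair_diff x q =
  \sum_j (x (lift ord0 j) - x ord0) * (net_flow (restrict_flow c) j - c (cone_pair j)).
Proof.
pose y j := x (lift ord0 j) - x ord0; pose d := restrict_flow c.
rewrite sum_pairs_split; under [RHS]eq_bigr do rewrite mulrBr.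
rewrite sumrB addrC; congr (_ + _); last first.
  by rewrite -sumrN; apply: eq_bigr => j _; rewrite /pair_diff/=; ring.
transitivity (\sum_p (d p * y (val p).1 - d p * y (val p).2)).
  by apply: eq_bigr => p _; rewrite /pair_diff /d /y ffunE /=; ring.
rewrite sumrB (partition_big (fun p : pairs k => (val p).1) xpredT)//=.
rewrite [X in _ - X](partition_big (fun p : pairs k => (val p).2) xpredT)//=.
rewrite -sumrB; apply: eq_bigr => j _; rewrite /net_flow mulrBr; congr (_ - _).
  by rewrite mulr_sumr; apply: eq_bigr => p /eqP <-; rewrite mulrC.
by rewrite mulr_sumr; apply: eq_bigr => p /eqP <-; rewrite mulrC.
Qed.

Lemma extend_flow_circulation d : circulation (extend_flow d).
Proof.
apply/forallP => x; rewrite sum_flow big1// => j _.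
have -> : restrict_flow (extend_flow d) = d.
  by apply/ffunP => p; rewrite ffunE extend_flow_lift.
by rewrite extend_flow_cone subrr mulr0.
Qed.

Lemma restrict_flowK c : circulation c -> extend_flow (restrict_flow c) = c.
Proof.
move=> /forallP circ; apply/ffunP => q.
case: (cone_or_lift q) => [[j ->]|[p ->]]; last by rewrite extend_flow_lift ffunE.
rewrite extend_flow_cone; apply/eqP; rewrite -subr_eq0.
(* The indicator of one vertex as potential isolates the [j]-th equation. *)
have := circ [ffun l => (l == lift ord0 j)%:R]; rewrite sum_flow (bigD1 j)//= big1 ?addr0.
  by rewrite !ffunE eqxx (negbTE (neq_lift _ _)) subr0 mul1r.
move=> i ij; rewrite !ffunE (inj_eq (@lift_inj _ ord0)) (negbTE ij).
by rewrite (negbTE (neq_lift _ _)) subrr mul0r.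
Qed.

Lemma card_circulation :
  #|[pred c : {ffun pairs k.+1 -> 'I_g} | circulation c]| = (g ^ 'C(k, 2))%N.
Proof.
rewrite -(card_pairs k) -[X in (X ^ _)%N](card_ord g) -card_ffun.
have ext_inj : injective extend_flow.
  apply: (can_inj (g := restrict_flow)) => d; apply/ffunP => p.
  by rewrite ffunE extend_flow_lift.
rewrite -(fintype.card_image ext_inj); apply: eq_card => c; rewrite [LHS]inE; apply/idP/fintype.imageP => [circ|[d _ ->]].
  by exists (restrict_flow c) => //; rewrite restrict_flowK.
exact: extend_flow_circulation.
Qed.

End card_circulation.

(** * The two bounds *)

Lemma sqrtrX_nat (R : rcfType) (x : R) n : 0 <= x -> Num.sqrt (x ^+ n) = Num.sqrt x ^+ n.
Proof.
move=> x0; rewrite -[in LHS](sqr_sqrtr x0) exprAC sqrtr_sqr ger0_norm//.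
Qed.

(** The half powers of [g], [C(k, 2)] from the block prefactors and [d] from the one-dimensional
    factors, add up to [g C(k, 2)]. *)
Lemma main_coefE (R : realType) (k g t : nat) (s : R) : (0 < g)%N -> (0 < t)%N ->
  g%:R ^+ 'C(k.-1, 2) *
    (Num.sqrt g%:R * (Num.sqrt (g%:R / (2 * pi * t%:R)) * s) ^+ g.-1) ^+ 'C(k, 2) =
  main_coef R k g t * s ^+ dimd k g.
Proof.
move=> g0 t0; have pi0 := pi_gt0 R.
have gR : 0 < g%:R :> R by rewrite ltr0n.
have tR : 0 < 2 * pi * t%:R :> R by rewrite !mulr_gt0// ltr0n.
rewrite /main_coef sqrtrX_nat ?(ltW tR)// powRD; last by rewrite (gt_eqF gR) implybT.
rewrite powR_mulrn ?(ltW gR)//.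
have -> : g%:R / 2 * ('C(k, 2))%:R = (g * 'C(k, 2))%N%:R / 2 :> R by rewrite natrM; field.
rewrite powR_half_natmul ?(ltW gR)// sqrtrM ?(ltW gR)// sqrtrV ?(ltW tR)//.
rewrite !exprMn -!exprM (_ : (g.-1 * 'C(k, 2))%N = dimd k g); last first.
  by rewrite /dimd subn1 mulnC.
have -> : (g * 'C(k, 2) = 'C(k, 2) + dimd k g)%N by rewrite /dimd; nia.
rewrite exprD exprVn; field; rewrite expf_neq0// gt_eqF// sqrtr_gt0//.
Qed.

Section box_sum.
Variables (R : realType) (k g1 N m t : nat) (delta : R).
Local Notation g := g1.+2.
Local Notation G := (g%:R : R).
Local Notation box := {ffun coord k g -> 'I_(2 * m).+1}.
Local Notation d := (dimd k g).
Let r : R := Num.sqrt t%:R / G.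
Let G0 : 0 < G. Proof. by rewrite ltr0n. Qed.

Definition box_quad (b : box) : R :=
  (\sum_x phase (box_angle R N b) x ^+ 2) / #|{: {ffun 'I_k -> 'I_g}}|%:R.

Lemma sum_box_weight :
  \sum_(b : box) expR (- (t%:R * box_quad b / 2)) =
  (\sum_(v : {ffun nonzero_residue g -> 'I_(2 * m).+1})
     block_weight r (@grid_point R N m \o v)) ^+ 'C(k, 2).
Proof.
rewrite -card_pairs -prodr_const bigA_distr_bigA/=.
rewrite (reindex (fun f : {ffun pairs k -> {ffun nonzero_residue g -> 'I_(2 * m).+1}} =>
  [ffun c => f (coord_pair c) (coord_residue c)] : box))/=; last first.
  exists (fun b => [ffun p => [ffun a => b (mkcoord p a)]]) => [f _|b _].
    by apply/ffunP => p; apply/ffunP => a; rewrite !ffunE coord_pairK coord_residueK.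
  by apply/ffunP => c; rewrite !ffunE mkcoordK.
apply: eq_bigr => f _; rewrite /block_weight -expR_sum_fin; congr expR.
rewrite /box_quad sum_phase_sqr mulr_sumr mulr_suml -sumrN; apply: eq_bigr => p _.
rewrite card_nonzero_residue/= /pair_mean.
have boxE a : box_angle R N ([ffun c => f (coord_pair c) (coord_residue c)] : box)
    (mkcoord p a) = grid_point R N (f p a).
  by rewrite /box_angle ffunE coord_pairK coord_residueK.
under eq_bigr do rewrite boxE; under [X in _ - (X / _) ^+ 2]eq_bigr do rewrite boxE.
have -> : r ^+ 2 = t%:R / G ^+ 2 by rewrite /r expr_div_n sqr_sqrtr ?ler0n.
rewrite /=; set u := \sum_a _ ^+ 2; set v := \sum_a _.
by field; rewrite gt_eqF.
Qed.

Hypotheses (delta0 : 0 <= delta) (dd : d%:R * delta <= 10^-1).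
Hypothesis mh : m%:R * (2 * pi / N%:R) <= delta.

Lemma box_angle_le (b : box) c : `|box_angle R N b c| <= delta.
Proof.
have h0 : 0 <= 2 * pi / N%:R :> R by rewrite divr_ge0// mulr_ge0// pi_ge0.
rewrite /box_angle /grid_point normrM (ger0_norm h0) mulrC; apply: le_trans mh.
rewrite ler_wpM2r// ler_norml; have := ler0n R (b c).
have : (b c)%:R <= 2 * m%:R :> R by rewrite -natrM ler_nat -ltnS.
by move=> ? ?; apply/andP; split; lra.
Qed.

Let cardpt0 : 0 < #|{: {ffun 'I_k -> 'I_g}}|%:R :> R.
Proof. by rewrite card_point exprn_gt0. Qed.

Lemma box_charsum_upper (b : box) : complex.Re (charsum (box_angle R N b) ^+ t) <=
  (G ^+ k) ^+ t * ((1 + (d%:R * delta) ^+ 6 / 4) `^ (t%:R / 2) *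
    (1 + (d%:R * delta) ^+ 4 / 3) ^+ t) * expR (- (t%:R * box_quad b / 2)).
Proof.
apply: le_trans (ler_norm _) _; apply: le_trans (Re_le_normc _) _; rewrite normcX.
have D0 : 0 <= d%:R * delta by rewrite mulr_ge0.
apply: le_trans (local_upper D0 dd (fun x => phase_le x (box_angle_le b))
  (sum_phase _) cardpt0 t) _.
by rewrite -/(box_quad b) card_point le_eqVlt; apply/orP; left; apply/eqP; ring.
Qed.

Lemma box_charsum_lower (b : box) : t%:R * (d%:R * delta) ^+ 3 < 2 ->
  (G ^+ k) ^+ t * ((1 + t%:R ^+ 2 * (d%:R * delta) ^+ 6) `^ (- (1 / 2)) *
    (1 - (d%:R * delta) ^+ 4 / 3) ^+ t) * expR (- (t%:R * box_quad b / 2)) <=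
  complex.Re (charsum (box_angle R N b) ^+ t).
Proof.
move=> tD; have D0 : 0 <= d%:R * delta by rewrite mulr_ge0.
apply: le_trans (local_lower D0 dd (fun x => phase_le x (box_angle_le b))
  (sum_phase _) cardpt0 tD).
by rewrite -/(box_quad b) card_point le_eqVlt; apply/orP; left; apply/eqP; ring.
Qed.

End box_sum.

(** The Riemann errors enter as [C / N] inside powers; reading the whole bound as a polynomial in
    [C / N] reduces the limit to continuity. *)
Lemma cvg_horner_inv (R : realType) (p : {poly R}) (C : R) (g : nat) : (0 < g)%N ->
  p.[C / (g * n.+1)%N%:R] @[n --> \oo] --> p.[0].
Proof.
move=> g0; have E : (fun n => p.[C / (g * n.+1)%N%:R]) =
    (fun n => p.[C / g%:R * harmonic n]).
  by apply/funext => n; rewrite /harmonic natrM invfM mulrA.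
rewrite E; apply: (cvg_comp (fun n => C / g%:R * harmonic n) (horner p)); last first.
  exact: continuous_horner.
by rewrite -[0](mulr0 (C / g%:R)); apply: cvgM; [exact: cvg_cst|exact: cvg_harmonic].
Qed.

Lemma bin2_mul2_le k : ('C(k, 2) * 2 <= k ^ 2)%N.
Proof.
by have := bin_ffact k 2; rewrite (_ : 2`! = 2)%N// => ->; rewrite ffactnS ffactn1; nia.
Qed.

Lemma dimd_le k g : (dimd k g <= 'C(k, 2) * g)%N.
Proof. by rewrite /dimd leq_mul2l leq_subr orbT. Qed.

(** * Choice of the mesh and passage to the limit *)

Section main.
Variables (R : realType) (k1 g1 t : nat) (D1 D2 delta : R).
Local Notation k := k1.+1.
Local Notation g := g1.+2.
Local Notation G := (g%:R : R).
Local Notation d := (dimd k g).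
Hypotheses (k2 : (1 < k)%N) (D10 : 0 < D1) (D20 : 0 < D2) (good : good_constants k g D1 D2).
Hypotheses (delta0 : 0 < delta) (deltaub : delta < 8 / 5 * (g%:R ^- (k + 3)) * (k%:R ^- 2)).
Hypotheses (t0 : (0 < t)%N) (gt : (g %| t)%N) (tub : t%:R < 2 * (d%:R * delta) ^- 3).
Hypothesis parity : odd g || (~~ odd g && ~~ odd (t %/ g)).
Let G0 : 0 < G. Proof. by rewrite ltr0n. Qed.
Let tR0 : 0 < t%:R :> R. Proof. by rewrite ltr0n. Qed.
Let err := err_term k g t delta.

(** Since [g] and [k] are at least [2], [g ^ (k + 2) >= 16], and [(8 / 5) / 16 = 1 / 10]. The
    conditions [dd], [small] and [Gdelta] all follow from this. *)
Let Gk2delta : G * k%:R ^+ 2 * delta < 10^-1.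
Proof.
have k0 : 0 < k%:R :> R by rewrite ltr0n.
have G2 : 2 <= G by rewrite (ler_nat R 2).
have Gk : 16 <= G ^+ (k + 2).
  apply: (@le_trans _ _ (2 ^+ (k + 2))); last by rewrite lerXn2r ?nnegrE// ltW.
  by rewrite -natrX ler_nat (@leq_pexp2l 2 4)// !addn2.
have Gk0 : 0 < G ^+ (k + 2) by rewrite exprn_gt0.
have H : delta * (G * G ^+ (k + 2) * k%:R ^+ 2) < 8 / 5.
  move: deltaub; rewrite (_ : (k + 3 = (k + 2).+1)%N) ?exprS ?addnS// -exprS.
  rewrite -mulrA -invfM -ltr_pdivrMr ?invr_gt0 ?mulr_gt0 ?exprn_gt0// invrK.
  by rewrite exprS.
have : 0 < G * k%:R ^+ 2 * delta by rewrite !mulr_gt0 ?exprn_gt0.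
nra.
Qed.

Let C2_le : ('C(k, 2))%:R * 2 <= k%:R ^+ 2 :> R.
Proof.
by rewrite -natrM -natrX ler_nat bin2_mul2_le.
Qed.

Let k4 : 4 <= k%:R ^+ 2 :> R.
Proof. by rewrite -natrX ler_nat (@leq_exp2r 2 k 2). Qed.

Let d_le : d%:R <= ('C(k, 2))%:R * G.
Proof. by rewrite -natrM ler_nat dimd_le. Qed.

Let d0 : 0 < d%:R :> R.
Proof. by rewrite ltr0n /dimd muln_gt0 bin_gt0 k2 subn_gt0. Qed.

Let dd : d%:R * delta <= 10^-1.
Proof.
have H : d%:R * delta <= ('C(k, 2))%:R * G * delta by rewrite ler_pM2r.
have := Gk2delta; have := ler_wpM2r (ltW (mulr_gt0 G0 delta0)) C2_le.
have := mulr_gt0 d0 delta0; lra.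
Qed.

Let small : G * (('C(k, 2))%:R + 4) * delta <= 2.
Proof.
have Gd := mulr_gt0 G0 delta0; have := Gk2delta.
have := ler_wpM2r (ltW Gd) C2_le; have := ler_wpM2r (ltW Gd) k4; lra.
Qed.

Let Gdelta : G * delta < 1.
Proof.
have Gd := mulr_gt0 G0 delta0; have := Gk2delta.
have := ler_wpM2r (ltW Gd) k4; lra.
Qed.

Let delta1 : delta <= 1.
Proof.
by apply: ltW; apply: le_lt_trans Gdelta; rewrite ler_peMl ?(ltW delta0)// ler1n.
Qed.

Let tD3 : t%:R * (d%:R * delta) ^+ 3 < 2.
Proof. by rewrite -ltr_pdivlMr// exprn_gt0// mulr_gt0. Qed.

Let even_t : ~~ odd ((t %/ g) * g.-1).
Proof.
by rewrite oddM /=; move: parity; rewrite /= negbK; case: (odd g1); case: (odd (t %/ g)).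
Qed.

Let mesh (n1 : nat) := 2 * pi / (g * n1)%N%:R : R.
Let half_width (n1 : nat) := Num.truncn (delta / mesh n1).
Let block_sum (n1 : nat) : R :=
  (\sum_(v : {ffun nonzero_residue g -> 'I_(2 * half_width n1).+1})
     block_weight (Num.sqrt t%:R / G) (@grid_point R (g * n1) (half_width n1) \o v))
  / (g * n1)%N%:R ^+ g.-1.

(** In [t + 8], the [t] ensures [N > t] and the [8], being at least [2 pi], a mesh at most [1]. The
    boxes fit because [2 delta < 2 pi / g]. *)
Let fine_mesh (n1 : nat) : (t + 8 <= n1)%N ->
  [/\ 0 < (g * n1)%N%:R :> R, mesh n1 <= 1, (half_width n1)%:R * mesh n1 <= delta,
     delta < ((half_width n1)%:R + 1) * mesh n1 & (2 * half_width n1 < n1)%N /\ (t < g * n1)%N].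
Proof.
move=> tn; have pi0 := pi_gt0 R; have pi4 := pihalf_lt2 R; have pi2 := pi_ge2 R.
have tn1 : (t < n1)%N by apply: leq_trans tn; rewrite addnS ltnS leq_addr.
have n1g : (n1 <= g * n1)%N by rewrite leq_pmull.
have n10 : (0 < n1)%N by apply: leq_ltn_trans tn1.
have N0 : 0 < (g * n1)%N%:R :> R by rewrite ltr0n muln_gt0.
have h0 : 0 < mesh n1 by rewrite divr_gt0// mulr_gt0.
have /andP[H1 H2] := truncn_itv (ltW (divr_gt0 delta0 h0)).
have mh : (half_width n1)%:R * mesh n1 <= delta by rewrite -ler_pdivlMr.
split=> //.
- rewrite /mesh ler_pdivrMr// mul1r; apply: (@le_trans _ _ 8); first lra.
  by rewrite ler_nat (leq_trans _ n1g)// (leq_trans _ tn)// leq_addl.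
- by rewrite -ltr_pdivrMr// natr1.
- split; last exact: leq_trans tn1 n1g.
  rewrite -(ltr_nat R) -(ltr_pM2r h0) natrM -mulrA.
  apply: (@le_lt_trans _ _ (2 * delta)); first by rewrite ler_pM2l.
  rewrite /mesh natrM (_ : n1%:R * _ = 2 * pi / G); last first.
    have n1R : 0 < n1%:R :> R by rewrite ltr0n.
    by field_pi.
  by rewrite ltr_pdivlMr//; have := Gdelta; lra.
Qed.

Let prob_upper_grid (n1 : nat) : (t + 8 <= n1)%N ->
  prob_return R k g t <= G ^+ 'C(k.-1, 2) *
    ((1 + (d%:R * delta) ^+ 6 / 4) `^ (t%:R / 2) * (1 + (d%:R * delta) ^+ 4 / 3) ^+ t) *
    block_sum n1 ^+ 'C(k, 2) + err.
Proof.
move=> tn; have [N0 h1 mh mh' [mn tN]] := fine_mesh tn.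
have := @prob_return_grid R k g1 (g * n1) n1 (half_width n1) t delta erefl mn tN
  delta0 delta1 small mh' gt even_t.
rewrite card_circulation natrX ler_norml => /andP[_].
set F := _ * (1 + _ ^+ 4 / 3) ^+ t; set S := \sum_b _; set n := (G ^+ k) ^+ t.
have n0 : 0 < n by rewrite !exprn_gt0.
have SF : S <= n * F * (block_sum n1 * (g * n1)%N%:R ^+ g.-1) ^+ 'C(k, 2).
  rewrite /block_sum mulfVK ?expf_neq0 ?gt_eqF// -sum_box_weight mulr_sumr.
  by apply: ler_sum => b _; exact: (box_charsum_upper t (ltW delta0) dd mh).
have Nd : (g * n1)%N%:R ^+ d = ((g * n1)%N%:R ^+ g.-1) ^+ 'C(k, 2) :> R.
  by rewrite -exprM; congr (_ ^+ _); rewrite /dimd subn1 mulnC.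
rewrite Nd; rewrite exprMn in SF; set M := ((g * n1)%N%:R ^+ g.-1) ^+ 'C(k, 2) in SF *.
have M0 : 0 < M by rewrite !exprn_gt0.
set Q := block_sum n1 ^+ _ in SF *; set c0 := G ^+ _; set P := prob_return _ _ _ _.
have c00 : 0 <= c0 by rewrite exprn_ge0// ltW.
have := ler_wpM2l c00 SF => H1 H2.
have nM : 0 < n * M by rewrite mulr_gt0.
rewrite -(ler_pM2r nM); move: H1 H2; rewrite -/err; lra.
Qed.

Let prob_lower_grid (n1 : nat) : (t + 8 <= n1)%N ->
  G ^+ 'C(k.-1, 2) *
    ((1 + t%:R ^+ 2 * (d%:R * delta) ^+ 6) `^ (- (1 / 2)) * (1 - (d%:R * delta) ^+ 4 / 3) ^+ t) *
    block_sum n1 ^+ 'C(k, 2) - err <= prob_return R k g t.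
Proof.
move=> tn; have [N0 h1 mh mh' [mn tN]] := fine_mesh tn.
have := @prob_return_grid R k g1 (g * n1) n1 (half_width n1) t delta erefl mn tN
  delta0 delta1 small mh' gt even_t.
rewrite card_circulation natrX ler_norml => /andP[+ _].
set F := _ * (1 - _ ^+ 4 / 3) ^+ t; set S := \sum_b _; set n := (G ^+ k) ^+ t.
have n0 : 0 < n by rewrite !exprn_gt0.
have SF : n * F * (block_sum n1 * (g * n1)%N%:R ^+ g.-1) ^+ 'C(k, 2) <= S.
  rewrite /block_sum mulfVK ?expf_neq0 ?gt_eqF// -sum_box_weight mulr_sumr.
  by apply: ler_sum => b _; exact: (box_charsum_lower (ltW delta0) dd mh).
have Nd : (g * n1)%N%:R ^+ d = ((g * n1)%N%:R ^+ g.-1) ^+ 'C(k, 2) :> R.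
  by rewrite -exprM; congr (_ ^+ _); rewrite /dimd subn1 mulnC.
rewrite Nd; rewrite exprMn in SF; set M := ((g * n1)%N%:R ^+ g.-1) ^+ 'C(k, 2) in SF *.
have M0 : 0 < M by rewrite !exprn_gt0.
set Q := block_sum n1 ^+ _ in SF *; set c0 := G ^+ _; set P := prob_return _ _ _ _.
have c00 : 0 <= c0 by rewrite exprn_ge0// ltW.
have := ler_wpM2l c00 SF => H1 H2.
have nM : 0 < n * M by rewrite mulr_gt0.
rewrite -(ler_pM2r nM); move: H1 H2; rewrite -/err; lra.
Qed.

Let block_sum_ge0 n1 : 0 <= block_sum n1.
Proof.
by rewrite divr_ge0 ?exprn_ge0 ?ler0n// sumr_ge0// => v _; exact: expR_ge0.
Qed.

Let limit_poly (c f b : R) : {poly R} :=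
  c%:P * ((Num.sqrt G)%:P * (b%:P + 'X) ^+ g.-1) ^+ 'C(k, 2) + f%:P.

Let limit_polyE c f b x :
  (limit_poly c f b).[x] = c * (Num.sqrt G * (b + x) ^+ g.-1) ^+ 'C(k, 2) + f.
Proof. by rewrite /limit_poly !(hornerD, hornerM, horner_exp, hornerC, hornerX). Qed.

Let factor_eq (F b : R) : G ^+ 'C(k.-1, 2) * F *
    (Num.sqrt G * (Num.sqrt (G / (2 * pi * t%:R)) * b) ^+ g.-1) ^+ 'C(k, 2) =
  main_coef R k g t * (F * b ^+ d).
Proof. by rewrite mulrAC main_coefE// mulrAC mulrA. Qed.

Lemma prob_return_upper :
  prob_return R k g t <= main_coef R k g t * Ubd k g t D2 delta + err.
Proof.
set E := t%:R * (D2 * delta) ^+ 2.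
have e0 : 0 <= 1 - expR (- E).
  by rewrite subr_ge0 expR_le1 oppr_le0 mulr_ge0 ?sqr_ge0.
set F := (1 + (d%:R * delta) ^+ 6 / 4) `^ (t%:R / 2) * (1 + (d%:R * delta) ^+ 4 / 3) ^+ t.
have dR0 : 0 <= d%:R * delta by rewrite mulr_ge0 ?ler0n// ltW.
have F0 : 0 <= F.
  by rewrite mulr_ge0 ?powR_ge0// exprn_ge0// addr_ge0// divr_ge0// exprn_ge0.
have E3 : (2 < g)%N -> t%:R * delta ^+ 2 / G <= E.
  move=> g3; rewrite (_ : E = t%:R * delta ^+ 2 * D2 ^+ 2) ?ler_wpM2l//; last by rewrite /E; ring.
    by rewrite mulr_ge0 ?sqr_ge0 ?ler0n.
  exact: (good_constants_D2 (isT : (1 < g)%N) k2 D20 good g3).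
have E2 : g = 2%N -> t%:R * delta ^+ 2 / 4 <= E.
  move=> gE; rewrite (_ : E = t%:R * delta ^+ 2 * D2 ^+ 2) ?ler_wpM2l//; last by rewrite /E; ring.
    by rewrite mulr_ge0 ?sqr_ge0 ?ler0n.
  exact: (good_constants_D2_two (isT : (1 < g)%N) k2 D20 good gE).
have [C C0 blockC] := block_upper (isT : (1 < g)%N) (card_nonzero_residue g) tR0 delta0 E3 E2.
set b := Num.sqrt (G / (2 * pi * t%:R)) * Num.sqrt (1 - expR (- E)).
have b0 : 0 <= b by rewrite mulr_ge0 ?sqrtr_ge0.
have -> : main_coef R k g t * Ubd k g t D2 delta + err =
    (limit_poly (G ^+ 'C(k.-1, 2) * F) err b).[0].
  rewrite limit_polyE addr0 factor_eq /Ubd -/d -(powR_half_natmul _ e0).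
  by rewrite mulNr.
have cvgP := @cvg_horner_inv R (limit_poly (G ^+ 'C(k.-1, 2) * F) err b) C _ (ltn0Sn g1.+1).
apply: (cvgr_to_ge cvgP).
near=> n; have tn : (t + 8 <= n.+1)%N by apply: leqW; near: n; exact: nbhs_infty_ge.
apply: le_trans (prob_upper_grid tn) _; rewrite limit_polyE lerD2r.
have cF0 : 0 <= G ^+ 'C(k.-1, 2) * F by rewrite mulr_ge0// exprn_ge0// ltW.
apply: (ler_wpM2l cF0).
have [N0 h1 mh _ _] := fine_mesh tn.
rewrite lerXn2r ?nnegrE ?block_sum_ge0//; last exact: blockC.
by rewrite mulr_ge0 ?sqrtr_ge0// exprn_ge0// addr_ge0// divr_ge0.
Unshelve. all: by end_near. Qed.

Lemma prob_return_lower :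
  main_coef R k g t * Lbd k g t D1 delta - err <= prob_return R k g t.
Proof.
set E := t%:R / 2 * (D1 * delta) ^+ 2.
have E0 : 0 < E by rewrite mulr_gt0 ?divr_gt0// exprn_gt0// mulr_gt0.
have e0 : 0 < 1 - expR (- E) by rewrite subr_gt0 expR_lt1 oppr_lt0.
set F := (1 + t%:R ^+ 2 * (d%:R * delta) ^+ 6) `^ (- (1 / 2)) *
  (1 - (d%:R * delta) ^+ 4 / 3) ^+ t.
have F0 : 0 <= F.
  rewrite mulr_ge0 ?powR_ge0// exprn_ge0// subr_ge0.
  have : (d%:R * delta) ^+ 4 <= 1.
    rewrite exprn_ile1//; first by rewrite mulr_ge0 ?ler0n// ltW.
    by apply: le_trans dd _; lra.
  by lra.
have E1 : E <= t%:R * delta ^+ 2 / (4 * G).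
  have D1g := good_constants_D1 (isT : (1 < g)%N) k2 D10 good.
  rewrite (_ : E = t%:R * delta ^+ 2 * (D1 ^+ 2 / 2)) ?ler_wpM2l//; last by rewrite /E; field.
    by rewrite mulr_ge0 ?ler0n ?sqr_ge0.
  apply: (@le_trans _ _ ((G ^+ 2)^-1 / 2)); first by rewrite ler_pM2r ?invr_gt0.
  rewrite -invfM lef_pV2 ?posrE ?mulr_gt0 ?exprn_gt0//.
  have : 2 <= G by rewrite (ler_nat R 2).
  by nra.
have [C C0 blockC] := block_lower (isT : (1 < g)%N) (card_nonzero_residue g) tR0 delta0 E1.
set b := Num.sqrt (G / (2 * pi * t%:R)) * Num.sqrt (1 - expR (- E)).
have b0 : 0 < b.
  by rewrite mulr_gt0 ?sqrtr_gt0// divr_gt0// !mulr_gt0// pi_gt0.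
have -> : main_coef R k g t * Lbd k g t D1 delta - err =
    (limit_poly (G ^+ 'C(k.-1, 2) * F) (- err) b).[0].
  rewrite limit_polyE addr0 factor_eq /Lbd -/d -(powR_half_natmul _ (ltW e0)).
  by rewrite mulNr.
have cvgP := @cvg_horner_inv R (limit_poly (G ^+ 'C(k.-1, 2) * F) (- err) b) (- C) _ (ltn0Sn g1.+1).
apply: (cvgr_to_le cvgP).
(* [block_lower] requires [b - C / N >= 0], which holds for large [N] because [b > 0]. *)
have cvg0 : (b%:P + 'X).[- C / (g * n.+1)%N%:R] @[n --> \oo] --> b.
  have := @cvg_horner_inv R (b%:P + 'X) (- C) _ (ltn0Sn g1.+1).
  by rewrite hornerD hornerC hornerX addr0.
near=> n; have tn : (t + 8 <= n.+1)%N by apply: leqW; near: n; exact: nbhs_infty_ge.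
have bC : 0 <= b - C / (g * n.+1)%N%:R.
  have : 0 <= (b%:P + 'X).[- C / (g * n.+1)%N%:R] by near: n; exact: (cvgr_ge _ cvg0 _ b0).
  by rewrite hornerD hornerC hornerX mulNr.
apply: le_trans (prob_lower_grid tn); rewrite limit_polyE lerD2r mulNr.
have cF0 : 0 <= G ^+ 'C(k.-1, 2) * F by rewrite mulr_ge0// exprn_ge0// ltW.
apply: (ler_wpM2l cF0).
have [N0 h1 mh mh' _] := fine_mesh tn.
rewrite lerXn2r ?nnegrE ?block_sum_ge0//; last by apply: blockC => //; exact: ltW.
by rewrite mulr_ge0 ?sqrtr_ge0// exprn_ge0.
Unshelve. all: by end_near. Qed.

End main.

Local Close Scope classical_set_scope.
Unset Implicit Arguments.

Theorem theorem5p4 (R : realType) (g k t : nat) (D1 D2 delta : R) :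
  (2 <= g)%N -> (2 <= k)%N ->
  0 < D1 -> 0 < D2 -> good_constants k g D1 D2 ->
  0 < delta ->
  delta < 8 / 5 * (g%:R ^- (k + 3)) * (k%:R ^- 2) ->
  (0 < t)%N -> (g %| t)%N ->
  t%:R < 2 * ((dimd k g)%:R * delta) ^- 3 ->
  (odd g || (~~ odd g && ~~ odd (t %/ g))) ->
  prob_return R k g t <= main_coef R k g t * Ubd k g t D2 delta + err_term k g t delta /\
  prob_return R k g t >= main_coef R k g t * Lbd k g t D1 delta - err_term k g t delta.
Proof.
(* As a double successor, [g] gives ['I_g] its ring structure modulo [g]. *)
case: g => [|[|g1]]// _; case: k => [|k1]// k2.
move=> D10 D20 good delta0 deltaub t0 gt tub parity; split.
  exact: (prob_return_upper k2 D20 good delta0 deltaub t0 gt parity).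
exact: (prob_return_lower k2 D10 good delta0 deltaub t0 gt tub parity).
Qed.
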